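(* Let $\Phi\in\mathbb{C}^{p\times p}$ be unitary and let $\mathcal{A},\mathcal{B}\in\mathbb{C}^{n\times n\times p}$ be $\Phi$-Hermitian tensors. (i) (Upper bound) There exists a universal constant $C>0$ such that $$\Delta_{\Phi}(\mathcal{A},\mathcal{B})\le C\sum_{\omega=1}^{p}\bigl\|[\hat{\mathcal{A}}_{\Phi}^{(\omega)},\hat{\mathcal{B}}_{\Phi}^{(\omega)}]\bigr\|_F^2 .$$ (ii) (Lower bound on a class of positive measure) There exist a class of positive measure of tensors and a universal constant $c>0$ such that, on this class, $$\Delta_{\Phi}(\mathcal{A},\mathcal{B})\ge c\sum_{\omega=1}^{p}\bigl\|[\hat{\mathcal{A}}_{\Phi}^{(\omega)},\hat{\mathcal{B}}_{\Phi}^{(\omega)}]\bigr\|_F^2 .$$ (iii) (Transform sensitivity) There exist tensors $\mathcal{A},\mathcal{B}$ and unitary transforms $\Phi_1,\Phi_2\in\mathbb{C}^{p\times p}$ such that $$\Delta_{\Phi_1}(\mathcal{A},\mathcal{B})=0,\qquad \Delta_{\Phi_2}(\mathcal{A},\mathcal{B})\ge C_0\,p,$$ for some constant $C_0>0$ independent of $p$. Moreover, the mapping $\Phi\mapsto\Delta_{\Phi}(\mathcal{A},\mathcal{B})$ is continuous (and smooth in $\Phi$), hence locally Lipschitz on compact subsets of the unitary group $\mathcal{U}(p)$. (iv) (Vanishing condition) If $[\hat{\mathcal{A}}_{\Phi}^{(\omega)},\hat{\mathcal{B}}_{\Phi}^{(\omega)}]=0$ for all $\omega=1,\dots,p$,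 then $\Delta_{\Phi}(\mathcal{A},\mathcal{B})=0$. Consequently, on nontrivial tensor classes, the defect is quantitatively equivalent (up to universal constants) to the squared transform-domain noncommutativity, $$\Delta_{\Phi}(\mathcal{A},\mathcal{B})\asymp\sum_{\omega=1}^{p}\bigl\|[\hat{\mathcal{A}}_{\Phi}^{(\omega)},\hat{\mathcal{B}}_{\Phi}^{(\omega)}]\bigr\|_F^2,$$ and in general depends nontrivially on the choice of $\Phi$.
   Context: $n,p$ are positive integers. For a tensor $\mathcal{X}\in\mathbb{C}^{n\times n\times p}$ with frontal slices $\mathcal{X}^{(k)}\in\mathbb{C}^{n\times n}$ and a unitary $\Phi\in\mathbb{C}^{p\times p}$, the transformed slices are $\hat{\mathcal{X}}_{\Phi}^{(\omega)}=\sum_{k=1}^p\Phi_{\omega k}\mathcal{X}^{(k)}$, $\omega=1,\dots,p$, and the lifting is $\overline{\mathcal{X}}_{\Phi}=\operatorname{blockdiag}(\hat{\mathcal{X}}_{\Phi}^{(1)},\dots,\hat{\mathcal{X}}_{\Phi}^{(p)})$. A tensor is determined by its lifting. $\mathcal{A}\star_\Phi\mathcal{B}$, $\mathcal{A}\oplus_\Phi\mathcal{B}$, $\exp_\Phi(\mathcal{A})$ are the tensors whose liftings are $\overline{\mathcal{A}}_{\Phi}\overline{\mathcal{B}}_{\Phi}$, $\overline{\mathcal{A}}_{\Phi}+\overline{\mathcal{B}}_{\Phi}$, and the matrix exponential $\exp(\overline{\mathcal{A}}_{\Phi})$, respectively; $\operatorname{Tr}_\Phi(\mathcal{A})=\operatorname{Tr}(\overline{\mathcal{A}}_{\Phi})$.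 $\mathcal{A}$ is $\Phi$-Hermitian if $\overline{\mathcal{A}}_{\Phi}$ is Hermitian, i.e. all $\hat{\mathcal{A}}_{\Phi}^{(\omega)}$ are Hermitian. The Golden--Thompson defect is $$\Delta_{\Phi}(\mathcal{A},\mathcal{B})=\operatorname{Tr}_{\Phi}\bigl(\exp_{\Phi}(\mathcal{A})\star_{\Phi}\exp_{\Phi}(\mathcal{B})\bigr)-\operatorname{Tr}_{\Phi}\bigl(\exp_{\Phi}(\mathcal{A}\oplus_{\Phi}\mathcal{B})\bigr);$$ when $\Phi$ is varied with $\mathcal{A},\mathcal{B}$ fixed, the same formula is used (the blockwise matrix exponential is defined for arbitrary slices). $[X,Y]=XY-YX$ and $\|\cdot\|_F$ is the Frobenius norm. ''Universal constant'' means independent of the tensor dimensions $n$, $p$ and of the choice of $\Phi$. $f\asymp g$ means $c\,g\le f\le C\,g$ with such constants $c,C>0$.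
   Formalization: In (i) the constant C depends on the Frobenius norms of A and B (not on n, p or Φ), since no absolute constant works: for A=tσ_z, B=tσ_x the defect grows like e^{2t}/2 but the commutator term like t^4; the first part of (iii) is stated for n≥2, as the defect vanishes for n=1. *)

(* Defs.v *)
From HB Require Import structures.
From mathcomp Require Import all_boot all_order all_algebra.
From mathcomp Require Import sesquilinear spectral.
From mathcomp Require Import complex.
From mathcomp Require Import all_classical all_reals all_analysis.

Set Implicit Arguments.
Unset Strict Implicit.
Unset Printing Implicit Defensive.

Import Order.TTheory GRing.Theory Num.Theory.
Import numFieldNormedType.Exports.

Local Open Scope classical_set_scope.
Local Open Scope sesquilinear_scope.
Local Open Scope complex_scope.
Local Open Scope ring_scope.

Section Matrices.
Context {R : realType} {m : nat}.
Implicit Types X Y : 'M[R[i]]_m.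

Definition expmx X : 'M[R[i]]_m :=
  limn (series (fun k => (k`!%:R : R[i])^-1 *: X ^+ k)).

Definition commx X Y : 'M[R[i]]_m := X *m Y - Y *m X.

Definition frobenius X : R := Num.sqrt (\sum_i \sum_j ComplexField.Normc.normc (X i j) ^+ 2).

End Matrices.

Section Tensors.
Context {R : realType} {n p : nat}.

(* A tensor in C^(n x n x p), given by its p frontal slices. *)
Definition tensor (R : realType) (n p : nat) := {ffun 'I_p -> 'M[R[i]]_n}.

Implicit Types (Phi : 'M[R[i]]_p) (A B : tensor R n p).

Definition slice Phi A (w : 'I_p) : 'M[R[i]]_n :=
  \sum_(k < p) Phi w k *: A k.

Definition tlift Phi A : 'M[R[i]]_(\sum_(w < p) n) :=
  \mxdiag_(w < p) slice Phi A w.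

(* For unitary Phi, the tensor whose lifting has the same diagonal blocks as M
   (see tliftK and tunliftK below): the inverse transform is given by the adjoint
   of Phi. *)
Definition tunlift Phi (M : 'M[R[i]]_(\sum_(w < p) n)) : tensor R n p :=
  [ffun k => \sum_(w < p) (Phi^t*) k w *: submxblock M w w].

Definition tstar Phi A B := tunlift Phi (tlift Phi A *m tlift Phi B).
Definition tplus Phi A B := tunlift Phi (tlift Phi A + tlift Phi B).
Definition texp Phi A := tunlift Phi (expmx (tlift Phi A)).
Definition ttrace Phi A : R[i] := \tr (tlift Phi A).

Definition thermitian Phi A := tlift Phi A \is hermsymmx.

(* Complex-valued, as it is also evaluated at tensors that are not
   Phi-Hermitian.  The order on R[i] is the partial one: an inequality between
   two complex numbers says that their difference is real and nonnegative. *)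
Definition defect Phi A B : R[i] :=
  ttrace Phi (tstar Phi (texp Phi A) (texp Phi B))
  - ttrace Phi (texp Phi (tplus Phi A B)).

Definition noncomm Phi A B : R :=
  \sum_(w < p) frobenius (commx (slice Phi A w) (slice Phi B w)) ^+ 2.

Definition tfrobenius A : R := Num.sqrt (\sum_(k < p) frobenius (A k) ^+ 2).

End Tensors.

Section Lifting.
Context {R : realType} {n p : nat}.
Implicit Types (Phi : 'M[R[i]]_p) (A B : tensor R n p).

Lemma tliftK Phi : Phi \is unitarymx -> cancel (@tlift R n p Phi) (tunlift Phi).
Proof.
move=> Phi_unitary A; apply/ffunP => k; rewrite ffunE.
under eq_bigr => w _ do rewrite submxblock_diag /slice scaler_sumr.
rewrite exchange_big /=.
under eq_bigr => l _.
  under eq_bigr => w _ do rewrite scalerA.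
  rewrite -scaler_suml.
  have -> : \sum_(w < p) (Phi^t*) k w * Phi w l = (1%:M : 'M[R[i]]_p) k l.
    by rewrite -(mulVmx (unitarymx_unit Phi_unitary)) invmx_unitary // !mxE.
  over.
rewrite (bigD1 k) //= big1 ?addr0 => [|l lk]; first by rewrite mxE eqxx scale1r.
by rewrite mxE eq_sym (negPf lk) scale0r.
Qed.

Lemma tunliftK Phi (D : 'I_p -> 'M[R[i]]_n) : Phi \is unitarymx ->
  tlift Phi (tunlift Phi (\mxdiag_(w < p) D w)) = \mxdiag_(w < p) D w.
Proof.
move=> Phi_unitary; apply: eq_mxdiag => w; rewrite /slice.
under eq_bigr => k _ do rewrite ffunE scaler_sumr.
rewrite exchange_big /=.
under eq_bigr => v _.
  under eq_bigr => k _ do rewrite scalerA submxblock_diag.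
  rewrite -scaler_suml.
  have -> : \sum_(k < p) Phi w k * (Phi^t*) k v = (1%:M : 'M[R[i]]_p) w v.
    by rewrite -(unitarymxP Phi_unitary) !mxE.
  over.
rewrite (bigD1 w) //= big1 ?addr0 => [|v vw]; first by rewrite mxE eqxx scale1r.
by rewrite mxE eq_sym (negPf vw) scale0r.
Qed.

Lemma tlift_star Phi A B : Phi \is unitarymx ->
  tlift Phi (tstar Phi A B) = tlift Phi A *m tlift Phi B.
Proof.
move=> Phi_unitary; rewrite /tstar.
suff -> : tlift Phi A *m tlift Phi B =
    \mxdiag_(w < p) (slice Phi A w *m slice Phi B w) by rewrite tunliftK.
rewrite /tlift [X in _ *m X]/mxdiag mul_mxdiag_mxblock; apply: eq_mxblock => i j.
have [_|_] := eqVneq i j; last by rewrite mulmx0.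
by rewrite !conform_mx_id.
Qed.

Lemma tlift_plus Phi A B : Phi \is unitarymx ->
  tlift Phi (tplus Phi A B) = tlift Phi A + tlift Phi B.
Proof. by move=> Phi_unitary; rewrite /tplus -mxdiagD tunliftK. Qed.

End Lifting.

Section PositiveMeasure.
Context {R : realType}.

(* d-dimensional Lebesgue measure of a Borel set of R^d, by iterated
   integration over sections (the library's product measure is defined in the
   same way from two factors). *)
Fixpoint lebesgue_vol (d : nat) : set (d.-tuple (measurableTypeR R)) -> \bar R :=
  match d with
  | 0%N => fun S => \d_([tuple]) S
  | d'.+1 => fun S => (\int[lebesgue_measure]_(x in setT)
      lebesgue_vol [set t : d'.-tuple (measurableTypeR R) |
                    S [tuple of x :: t]])%E
  end.

(* n x n Hermitian matrices as an n^2-dimensional real space: x i j and x j i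
   (i < j) are the real and imaginary parts of the (i, j) entry. *)
Definition herm_of n (x : 'I_n -> 'I_n -> R) : 'M[R[i]]_n :=
  \matrix_(i, j)
    if (i < j)%N then x i j +i* x j i
    else if (j < i)%N then x j i -i* x i j
    else (x i i)%:C.

Definition pair_index n p := (bool * 'I_p * 'I_n * 'I_n)%type.

(* The pairs of Phi-Hermitian tensors as a 2pn^2-dimensional real space: the
   real coordinates are those of the Hermitian slices in the transform domain.
   For unitary Phi this is, up to rescaling coordinates, a linear isometry onto
   the space of pairs. *)
Definition herm_pair n p (Phi : 'M[R[i]]_p)
    (t : #|{: pair_index n p}|.-tuple (measurableTypeR R)) :
    tensor R n p * tensor R n p :=
  let T b := tunlift Phi (\mxdiag_(w < p)
    herm_of (fun i j : 'I_n => tnth t (enum_rank ((b, w, i, j) : pair_index n p))))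
  in (T false, T true).

Definition positive_measure_class n p (Phi : 'M[R[i]]_p)
    (S : set (tensor R n p * tensor R n p)) : Prop :=
  [/\ forall X, S X -> thermitian Phi X.1 /\ thermitian Phi X.2,
      measurable (herm_pair Phi @^-1` S)
    & (0 < lebesgue_vol (herm_pair Phi @^-1` S))%E].

End PositiveMeasure.

Section Smoothness.
Context {R : realType}.

(* C^k: the iterated directional derivatives up to order k exist everywhere and
   are continuous. *)
Fixpoint Ck (V : normedModType R) (k : nat) (f : V -> R^o) : Prop :=
  continuous f /\
  match k with
  | 0%N => True
  | k'.+1 => forall v : V, (forall x, derivable f x v) /\ Ck k' ('D_v f)
  end.

Definition smooth (V : normedModType R) (f : V -> R^o) := forall k, Ck k f.

(* The matrix space and the complex line with their norm topologies, named so
   that the structures can be inferred in statements about continuity. *)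
Definition mx_space p : normedModType R[i] := 'M[R[i]]_p.
Definition cplx_space : normedModType R[i] := R[i]^o.

Definition unitary_group p : set (mx_space p) :=
  [set Phi : 'M[R[i]]_p | Phi \is unitarymx].

(* C^infinity in the real sense, the space of complex matrices being identified
   with pairs (real part, imaginary part). *)
Definition mx_smooth p (F : 'M[R[i]]_p -> R[i]) : Prop :=
  let mk (X : 'M[R]_p * 'M[R]_p) := \matrix_(i, j) (X.1 i j +i* X.2 i j) in
  smooth (fun X => complex.Re (F (mk X)) : R^o) /\
  smooth (fun X => complex.Im (F (mk X)) : R^o).

(* Smoothness on the closed embedded submanifold U(p): existence of a smooth
   extension to the ambient matrix space. *)
Definition smooth_on_unitary p (f : 'M[R[i]]_p -> R[i]) : Prop :=
  exists2 F : 'M[R[i]]_p -> R[i],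
    mx_smooth F & forall Phi : mx_space p, unitary_group Phi -> F Phi = f Phi.

End Smoothness.

Arguments unitary_group R p : clear implicits.
Arguments mx_space R p : clear implicits.
Arguments cplx_space R : clear implicits.

(* Main.v *)
Require Import Defs.
From HB Require Import structures.
From mathcomp Require Import all_boot all_order all_algebra.
From mathcomp Require Import sesquilinear spectral.
From mathcomp Require Import complex.
From mathcomp Require Import all_classical all_reals all_analysis.
From mathcomp Require Import ring lra zify.

(** A unitary transform turns the defect into a sum, over the slices, of the gaps
    [\tr (expmx A *m expmx B) - \tr (expmx (A + B))] of pairs of matrices ([defectE]).
    All the estimates concern one such gap.

    The part of order [k] of the gap is, up to the factorial of [k], the sum over all words
    [w] of length [k] in the letters [A] and [B] of [\tr (sorted w) - \tr w]. Sorting a word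
    exchanges adjacent letters, and each exchange inserts a commutator [C] of [A] and [B], so
    the difference is a sum of traces of the form [\tr (C * word)]. These are quadratic in
    [C]: sorting the remaining word inserts a second commutator, and the sorted traces
    [\tr (C * A ^+ i * B ^+ j)] are averages of such differences, because the trace of
    [A ^+ i] times the commutator of [A] with a power of [B] is 0 ([tr_comm_sorted]).
    Counting exchanges bounds the part of order [k] by [2 * 32 ^+ k] times the squared norm
    of [C] when [A] and [B] have norm at most 1 ([GT_coeff_le1]). The Frobenius norm is
    submultiplicative, so no constant depends on the size of the matrices.

    Summing over [k] gives the upper bound and the vanishing condition
    ([GT_gap_herm_le], [defect_commuting]). The orders below 4 vanish and the order 4 gives
    exactly the squared norm of [C] over 24 for Hermitian matrices ([GT_coeff4]). By
    homogeneity the rest is small compared with it when [A] and [B] are small, so the gap lies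
    between [1 / 48] and [1 / 12] times the squared norm of [C] ([GT_gap_small]). The pairs of
    tensors with small slices form a box in the coordinates of the slices, and a box has
    positive volume ([small_pairs_positive]).

    For the Pauli matrices [X] and [Z] the gap of [a *: X] and [b *: Z] is
    [2 * (cosh a * cosh b - cosh (sqrt (a ^+ 2 + b ^+ 2)))]. Tensors with slices proportional
    to [X] and to [Z] thus have a large defect for one transform, while another transform
    separates the two directions and makes the slices commute ([sensitivity]).

    Regularity in the transform rests on the fact that a difference quotient of the
    exponential is a corner of the exponential of a block matrix
    ([expmx_difference_quotient]): the derivatives of the entries of the exponential of an
    affine matrix function are entries of the same kind. *)

Set Implicit Arguments.
Unset Strict Implicit.
Unset Printing Implicit Defensive.

Import Order.TTheory GRing.Theory Num.Theory.
Import numFieldNormedType.Exports.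

Local Open Scope classical_set_scope.
Local Open Scope complex_scope.
Local Open Scope ring_scope.
Local Open Scope sesquilinear_scope.

Import ComplexField.Normc.
Local Notation fro := (@frobenius _ _).

(** * Frobenius norm *)

(** By Lagrange's identity the difference of the two sides is half the sum of the
    squares of all [a i * b j - a j * b i]. *)
Lemma CauchySchwarz_sum (R : realFieldType) (I : finType) (a b : I -> R) :
  (\sum_i a i * b i) ^+ 2 <= (\sum_i a i ^+ 2) * (\sum_i b i ^+ 2).
Proof.
rewrite -subr_ge0 -(pmulr_rge0 _ (ltr0n R 2)).
suff -> : 2 * ((\sum_i a i ^+ 2) * (\sum_i b i ^+ 2) - (\sum_i a i * b i) ^+ 2)
    = \sum_i \sum_j (a i * b j - a j * b i) ^+ 2.
  by do 2![apply: sumr_ge0 => ? _]; rewrite sqr_ge0.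
transitivity (\sum_i \sum_j (a i ^+ 2 * b j ^+ 2 + b i ^+ 2 * a j ^+ 2
    - (2 * (a i * b i)) * (a j * b j))); last first.
  by apply: eq_bigr => i _; apply: eq_bigr => j _; ring.
under [RHS]eq_bigr do rewrite !big_split /= sumrN -!mulr_sumr.
rewrite !big_split /= sumrN -!mulr_suml -!mulr_sumr.
ring.
Qed.

Section Frobenius.
Context {R : realType}.

Lemma normc_norm (z : R[i]) : (normc z)%:C = `|z|.
Proof. by []. Qed.

Lemma normc_ge0 (z : R[i]) : 0 <= normc z.
Proof. by case: z => a b; exact: sqrtr_ge0. Qed.

Lemma normc_sum (I : Type) (r : seq I) (P : pred I) (f : I -> R[i]) :
  normc (\sum_(i <- r | P i) f i) <= \sum_(i <- r | P i) normc (f i).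
Proof.
elim/big_rec2: _ => [|i x y _ le_yx]; first by rewrite normc0.
by apply: le_trans (le_normcD _ _) _; rewrite lerD2l.
Qed.

Lemma normc_real (x : R) : normc x%:C = `|x|.
Proof. by rewrite /= expr0n addr0 sqrtr_sqr. Qed.

Lemma Re_le_normc (z : R[i]) : `|complex.Re z| <= normc z.
Proof. by rewrite -lecR; exact: normc_ge_Re. Qed.

Lemma Im_le_normc (z : R[i]) : `|complex.Im z| <= normc z.
Proof.
case: z => a b /=; rewrite -sqrtr_sqr ler_sqrt ?addr_ge0 ?sqr_ge0 //.
by rewrite lerDr sqr_ge0.
Qed.

Lemma normc_le_ReIm (z : R[i]) :
  normc z <= `|complex.Re z| + `|complex.Im z|.
Proof.
case: z => a b /=; rewrite -[leRHS]ger0_norm ?addr_ge0 // -[leRHS]sqrtr_sqr.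
rewrite ler_sqrt ?sqr_ge0 // sqrrD !real_normK ?num_real // [leRHS]addrAC lerDl.
by rewrite mulrn_wge0 // mulr_ge0.
Qed.

Context {m : nat}.
Implicit Types X Y : 'M[R[i]]_m.

Lemma frobenius_ge0 X : 0 <= fro X.
Proof. exact: sqrtr_ge0. Qed.

Lemma sqr_frobenius X : fro X ^+ 2 = \sum_i \sum_j normc (X i j) ^+ 2.
Proof.
rewrite sqr_sqrtr //.
by do 2![apply: sumr_ge0 => ? _]; rewrite exprn_ge0 ?normc_ge0.
Qed.

Lemma sqr_frobenius_pair X : fro X ^+ 2 = \sum_ij normc (X ij.1 ij.2) ^+ 2.
Proof. by rewrite sqr_frobenius pair_bigA. Qed.

Lemma le_sqr (x y : R) : 0 <= y -> x ^+ 2 <= y ^+ 2 -> x <= y.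
Proof.
move=> y0 xy; have [/ltW x0|x0] := ltP x 0; first exact: le_trans y0.
by rewrite -ler_sqr.
Qed.

Lemma frobeniusD X Y : fro (X + Y) <= fro X + fro Y.
Proof.
apply: le_sqr; first by rewrite addr_ge0 ?frobenius_ge0.
have CS := CauchySchwarz_sum (fun ij : 'I_m * 'I_m => normc (X ij.1 ij.2))
  (fun ij => normc (Y ij.1 ij.2)).
rewrite -!sqr_frobenius_pair -exprMn in CS.
have {}CS := le_sqr (mulr_ge0 (frobenius_ge0 X) (frobenius_ge0 Y)) CS.
rewrite sqrrD !sqr_frobenius_pair.
apply: le_trans
  (_ : \sum_ij (normc (X ij.1 ij.2) + normc (Y ij.1 ij.2)) ^+ 2 <= _).
  apply: ler_sum => ij _; rewrite mxE ler_sqr ?nnegrE ?addr_ge0 ?normc_ge0 //.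
  exact: le_normcD.
under eq_bigr do rewrite sqrrD.
by rewrite !big_split /= lerD2r lerD2l -mulr2n lerMn2r CS orbT.
Qed.

Lemma frobeniusZ a X : fro (a *: X) = normc a * fro X.
Proof.
rewrite -[LHS]ger0_norm ?frobenius_ge0 // -[RHS]ger0_norm; last first.
  by rewrite mulr_ge0 ?normc_ge0 ?frobenius_ge0.
rewrite -2!sqrtr_sqr exprMn !sqr_frobenius mulr_sumr; congr Num.sqrt.
apply: eq_bigr => i _; rewrite mulr_sumr; apply: eq_bigr => j _.
by rewrite mxE normcM exprMn.
Qed.

Lemma frobenius0 : fro (0 : 'M[R[i]]_m) = 0.
Proof.
by rewrite -[X in fro X](scale0r (0 : 'M[R[i]]_m)) frobeniusZ normc0 mul0r.
Qed.

Lemma frobeniusN X : fro (- X) = fro X.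
Proof. by rewrite -scaleN1r frobeniusZ normcN normc1 mul1r. Qed.

Lemma frobeniusB X Y : fro (X - Y) <= fro X + fro Y.
Proof. by rewrite -(frobeniusN Y) frobeniusD. Qed.

Lemma frobenius_sum (I : Type) (r : seq I) (P : pred I) (f : I -> 'M[R[i]]_m) :
  fro (\sum_(i <- r | P i) f i) <= \sum_(i <- r | P i) fro (f i).
Proof.
elim/big_rec2: _ => [|i x y _ le_yx]; first by rewrite frobenius0.
by apply: le_trans (frobeniusD _ _) _; rewrite lerD2l.
Qed.

Lemma normc_dot_le (I : finType) (f g : I -> R[i]) :
  normc (\sum_i f i * g i) ^+ 2 <=
  (\sum_i normc (f i) ^+ 2) * (\sum_i normc (g i) ^+ 2).
Proof.
apply: le_trans (CauchySchwarz_sum _ _).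
rewrite ler_sqr ?nnegrE ?normc_ge0 //.
  apply: le_trans (normc_sum _ _ _) _.
  by apply: ler_sum => i _; rewrite normcM.
by apply: sumr_ge0 => i _; rewrite mulr_ge0 ?normc_ge0.
Qed.

Lemma frobeniusM X Y : fro (X *m Y) <= fro X * fro Y.
Proof.
apply: le_sqr; first by rewrite mulr_ge0 ?frobenius_ge0.
rewrite exprMn !sqr_frobenius [X in _ <= _ * X]exchange_big /= mulr_suml.
apply: ler_sum => i _; rewrite mulr_sumr; apply: ler_sum => j _.
by rewrite mxE normc_dot_le.
Qed.

Lemma normc_trM X Y : normc (\tr (X *m Y)) <= fro X * fro Y.
Proof.
apply: le_sqr; first by rewrite mulr_ge0 ?frobenius_ge0.
have -> : \tr (X *m Y) = \sum_ij X ij.1 ij.2 * Y ij.2 ij.1.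
  rewrite -(pair_bigA _ (fun i j => X i j * Y j i)).
  by apply: eq_bigr => i _; rewrite mxE.
rewrite exprMn !sqr_frobenius [X in _ <= _ * X]exchange_big /= !pair_bigA.
exact: normc_dot_le.
Qed.

Lemma entry_le_frobenius X i j : normc (X i j) <= fro X.
Proof.
apply: le_sqr; first exact: frobenius_ge0.
rewrite sqr_frobenius_pair (bigD1 (i, j)) //= lerDl.
by apply: sumr_ge0 => ij _; rewrite exprn_ge0 ?normc_ge0.
Qed.

Lemma frobenius_le_sum X : fro X <= \sum_ij normc (X ij.1 ij.2).
Proof.
have sge0 (P : pred ('I_m * 'I_m)) : 0 <= \sum_(ij | P ij) normc (X ij.1 ij.2).
  by apply: sumr_ge0 => ij _; rewrite normc_ge0.
apply: le_sqr; first exact: sge0.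
rewrite sqr_frobenius_pair expr2 mulr_sumr; apply: ler_sum => ij _.
by rewrite expr2 ler_wpM2r ?normc_ge0 // [leRHS](bigD1 ij) //= lerDl sge0.
Qed.

Lemma frobenius_eq0 X : fro X = 0 -> X = 0.
Proof.
move=> X0; apply/matrixP => i j; rewrite mxE; apply: eq0_normc.
by apply/eqP; rewrite eq_le normc_ge0 andbT -X0 entry_le_frobenius.
Qed.

Lemma normc_tr X : normc (\tr X) <= m%:R * fro X.
Proof.
apply: le_trans (normc_sum _ _ _) _.
apply: le_trans (_ : \sum_(i < m) fro X <= _).
  by apply: ler_sum => i _; exact: entry_le_frobenius.
by rewrite sumr_const card_ord mulr_natl.
Qed.

End Frobenius.

(** * Convergence of complex matrices *)

Lemma null_add (R : realType) (f g : nat -> R) :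
  f @ \oo --> (0 : R) -> g @ \oo --> (0 : R) ->
  (fun n => f n + g n) @ \oo --> (0 : R).
Proof. by move=> f0 g0; have := cvgD f0 g0; rewrite addr0; exact. Qed.

Lemma null_mulr (R : realType) (f : nat -> R) (c : R) :
  f @ \oo --> (0 : R) -> (fun n => c * f n) @ \oo --> (0 : R).
Proof. by move=> f0; have := cvgM (cvg_cst c) f0; rewrite mulr0; exact. Qed.

Lemma null_sum (R : realType) (I : Type) (r : seq I) (f : I -> nat -> R) :
  (forall i, f i @ \oo --> (0 : R)) ->
  (fun n => \sum_(i <- r) f i n) @ \oo --> (0 : R).
Proof.
move=> f0; elim: r => [|i r IH].
  by under eq_fun do rewrite big_nil; exact: cvg_cst.
under eq_fun do rewrite big_cons.
have := cvgD (f0 i) IH; rewrite addr0; exact.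
Qed.

Section Convergence.
Context {R : realType} {m : nat}.
Implicit Types (X Y L : 'M[R[i]]_m) (u v : nat -> 'M[R[i]]_m).

(** Convergence is measured by the real-valued Frobenius norm, which is
    submultiplicative with no factor depending on the size; [mx_cvg_cvg] relates it
    to the topology of the space of matrices. *)
Definition mx_cvg u L := (fun n => fro (u n - L)) @ \oo --> (0 : R).

Lemma mx_cvg_le u L (a : nat -> R) :
  (forall n, fro (u n - L) <= a n) -> a @ \oo --> (0 : R) -> mx_cvg u L.
Proof.
move=> ua a0; apply: (squeeze_cvgr _ (@cvg_cst _ _ _ _ _) a0).
by apply: nearW => n; rewrite frobenius_ge0 ua.
Qed.

Lemma mx_cvg_close u v L a : mx_cvg u L ->
  (forall n, fro (v n - u n) <= a n) -> a @ \oo --> (0 : R) -> mx_cvg v L.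
Proof.
move=> uL vua a0; apply: (@mx_cvg_le _ _ (fun n => a n + fro (u n - L))).
  move=> n; apply: le_trans (_ : fro (v n - u n) + fro (u n - L) <= _).
    by rewrite -[v n - L](subrKA (u n)) frobeniusD.
  by rewrite lerD2r.
by apply: null_add.
Qed.

Lemma mx_cvgD u v L1 L2 : mx_cvg u L1 -> mx_cvg v L2 ->
  mx_cvg (fun n => u n + v n) (L1 + L2).
Proof.
move=> uL vL; apply: (@mx_cvg_le _ _ (fun n => fro (u n - L1) + fro (v n - L2))).
  by move=> n; rewrite opprD addrACA frobeniusD.
by apply: null_add.
Qed.

Lemma mx_cvgB u v L1 L2 : mx_cvg u L1 -> mx_cvg v L2 ->
  mx_cvg (fun n => u n - v n) (L1 - L2).
Proof.
move=> uL vL; apply: mx_cvgD => //.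
by apply: mx_cvg_le vL => n; rewrite -opprD frobeniusN.
Qed.

Lemma mx_cvg_bounded u L (a : R) : mx_cvg u L ->
  (forall n, fro (u n) <= a) -> fro L <= a.
Proof.
move=> uL ua; rewrite -subr_le0.
rewrite -(cvg_lim _ uL)//; apply: limr_ge; first by apply/cvg_ex; exists 0.
apply: nearW => n; rewrite lerBlDr.
apply: le_trans (_ : fro (u n - L) + fro (u n) <= _); last by rewrite lerD2l.
by rewrite addrC -{1}(subKr (u n) L) frobeniusB.
Qed.

Lemma mx_cvg_unique u L1 L2 : mx_cvg u L1 -> mx_cvg u L2 -> L1 = L2.
Proof.
move=> u1 u2; apply/eqP; rewrite -subr_eq0; apply/eqP/frobenius_eq0.
apply/eqP; rewrite eq_le frobenius_ge0 andbT.
have /(mx_cvg_bounded (a := 0)) : mx_cvg (fun=> 0) (L1 - L2); last first.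
  by apply => n; rewrite frobenius0.
apply: (@mx_cvg_le _ _ (fun n => fro (u n - L2) + fro (u n - L1))).
  move=> n; rewrite sub0r opprB.
  by rewrite -(subrKA (u n)) -[L2 - u n]opprB addrC (le_trans (frobeniusB _ _)) // addrC.
by apply: null_add.
Qed.

Lemma mx_cvgM u v L1 L2 : mx_cvg u L1 -> mx_cvg v L2 ->
  mx_cvg (fun n => u n *m v n) (L1 *m L2).
Proof.
move=> uL vL.
apply: (@mx_cvg_le _ _ (fun n =>
  fro (u n - L1) * fro (v n - L2) + fro (u n - L1) * fro L2 + fro L1 * fro (v n - L2))).
  move=> n.
  have -> : u n *m v n - L1 *m L2 = (u n - L1) *m (v n - L2) + (u n - L1) *m L2
      + L1 *m (v n - L2).
    by rewrite mulmxBr subrK mulmxBl mulmxBr addrA subrK.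
  apply: le_trans (frobeniusD _ _) _; apply: lerD (frobeniusM _ _).
  by apply: le_trans (frobeniusD _ _) _; apply: lerD; exact: frobeniusM.
apply: null_add; last exact: null_mulr.
apply: null_add; first by have := cvgM uL vL; rewrite mulr0; exact.
by under eq_fun do rewrite mulrC; exact: null_mulr.
Qed.

Lemma mx_cvg_tr u L : mx_cvg u L ->
  (fun n => normc (\tr (u n) - \tr L)) @ \oo --> (0 : R).
Proof.
move=> uL; have muL := null_mulr m%:R uL.
apply: (squeeze_cvgr _ (@cvg_cst _ _ _ _ _) muL).
by apply: nearW => n; rewrite normc_ge0 -raddfB normc_tr.
Qed.

Lemma mx_norm_le_frobenius X : `|X| <= (fro X)%:C.
Proof.
rewrite -[leLHS]/(mx_norm X).
have [->|/mx_norm_neq0[ij ->]] := eqVneq (mx_norm X) 0.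
  by rewrite lecR frobenius_ge0.
by rewrite -normc_norm lecR entry_le_frobenius.
Qed.

Lemma mx_cvg_cvg u L : mx_cvg u L ->
  (u : nat -> mx_space R m) @ \oo --> (L : mx_space R m).
Proof.
move=> uL; apply/cvgrPdist_lt => -[e e'].
rewrite ltcE /= => /andP[/eqP -> e0].
have /cvgrPdist_lt/(_ _ e0) := uL; apply: filterS => n; rewrite sub0r normrN.
rewrite ger0_norm ?frobenius_ge0 // => une.
by apply: le_lt_trans (mx_norm_le_frobenius _) _; rewrite -frobeniusN opprB ltcR.
Qed.

(** Absolute convergence for the Frobenius norm, read off on the real and
    imaginary parts of the entries. *)
Lemma mx_series_cvg u (a : nat -> R) : (forall k, fro (u k) <= a k) ->
  cvgn (series a) -> exists L, mx_cvg (series u) L.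
Proof.
move=> ua ca.
have a0 k : 0 <= a k := le_trans (frobenius_ge0 _) (ua k).
have cvg_part (f : 'M[R[i]]_m -> R) : (forall X, `|f X| <= fro X) ->
    cvgn (series (fun k => f (u k))).
  move=> fle; apply: (@normed_cvg _ R^o); apply: (series_le_cvg _ a0 _ ca) => k /=.
    exact: normr_ge0.
  exact: le_trans (fle _) (ua k).
pose re i j := (fun X : 'M[R[i]]_m => complex.Re (X i j)).
pose im i j := (fun X : 'M[R[i]]_m => complex.Im (X i j)).
have {}cvg_re i j : cvgn (series (fun k => re i j (u k))).
  by apply: cvg_part => X; apply: le_trans (Re_le_normc _) (entry_le_frobenius _ _ _).
have {cvg_part}cvg_im i j : cvgn (series (fun k => im i j (u k))).
  by apply: cvg_part => X; apply: le_trans (Im_le_normc _) (entry_le_frobenius _ _ _).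
pose lre i j := limn (series (fun k => re i j (u k))).
pose lim i j := limn (series (fun k => im i j (u k))).
exists (\matrix_(i, j) (lre i j +i* lim i j)).
apply: (@mx_cvg_le _ _ (fun n => \sum_(ij : 'I_m * 'I_m)
  (`|series (fun k => re ij.1 ij.2 (u k)) n - lre ij.1 ij.2| +
   `|series (fun k => im ij.1 ij.2 (u k)) n - lim ij.1 ij.2|))).
  move=> n; apply: le_trans (frobenius_le_sum _) _; apply: ler_sum => -[i j] _ /=.
  rewrite 3!mxE; apply: le_trans (normc_le_ReIm _) _.
  rewrite !raddfB /= /series /= !summxE !raddf_sum /=.
  exact: lexx.
apply: null_sum => -[i j].
have lim0 (f : nat -> R) : cvgn f -> (fun n => `|f n - limn f|) @ \oo --> (0 : R).
  by move=> cf; apply/norm_cvg0P/subr_cvg0.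
by apply: null_add; exact: lim0.
Qed.

End Convergence.

(** * The matrix exponential *)

Section Exponential.
Context {R : realType}.

Definition expS m (X : 'M[R[i]]_m) : nat -> 'M[R[i]]_m :=
  series (fun k => (k`!%:R : R[i])^-1 *: X ^+ k).

Lemma normc_factV k : normc ((k`!%:R : R[i])^-1) = (k`!%:R : R)^-1.
Proof.
rewrite normcV -(rmorph_nat (@real_complex R)).
by rewrite normc_real ger0_norm.
Qed.

Lemma frobenius_exprS m (X : 'M[R[i]]_m) k : fro (X ^+ k.+1) <= fro X ^+ k.+1.
Proof.
elim: k => [|k IH]; first by rewrite !expr1.
rewrite exprS [leRHS]exprS -mulmxE; apply: le_trans (frobeniusM _ _) _.
by rewrite ler_wpM2l ?frobenius_ge0.
Qed.

Lemma expS_cvg m (X : 'M[R[i]]_m) : mx_cvg (expS X) (expmx X).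
Proof.
have [L XL] : exists L, mx_cvg (expS X) L.
  (* the factor [1 + fro 1] covers the term of order 0, where [fro 1] may exceed 1 *)
  apply: (@mx_series_cvg _ _ _
    (fun k => (1 + fro (1 : 'M[R[i]]_m)) * exp_coeff (fro X) k)).
    move=> k; rewrite frobeniusZ normc_factV exp_coeffE mulrCA ler_wpM2l ?invr_ge0 //.
    case: k => [|k]; first by rewrite !expr0 mulr1 lerDr.
    apply: le_trans (frobenius_exprS _ _) _.
    by rewrite ler_peMl ?exprn_ge0 ?frobenius_ge0 // lerDl frobenius_ge0.
  have -> : series (fun k => (1 + fro (1 : 'M[R[i]]_m)) * exp_coeff (fro X) k) =
    (fun n => (1 + fro (1 : 'M[R[i]]_m)) * series (exp_coeff (fro X)) n).
    by apply/funext => n; rewrite /series /= mulr_sumr.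
  by apply: is_cvgM; [exact: is_cvg_cst | exact: is_cvg_series_exp_coeff].
suff -> : expmx X = L by [].
by apply: (@cvg_lim (mx_space R m)); [exact: norm_hausdorff | exact: mx_cvg_cvg].
Qed.

Lemma exp_coeff_partial_le (x : R) n : 0 <= x -> series (exp_coeff x) n <= expR x.
Proof.
move=> x0; apply: nondecreasing_cvgn_le.
  apply/nondecreasing_seqP => k; rewrite /series /= big_nat_recr //= lerDl.
  exact: exp_coeff_ge0.
exact: is_cvg_series_exp_coeff.
Qed.

Lemma frobenius_exprB m (X Y : 'M[R[i]]_m) (M : R) k : fro X <= M -> fro Y <= M ->
  fro (X ^+ k.+1 - Y ^+ k.+1) <= k.+1%:R * M ^+ k * fro (X - Y).
Proof.
move=> XM YM; have M0 : 0 <= M := le_trans (frobenius_ge0 _) XM.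
elim: k => [|k IH]; first by rewrite !expr1 expr0 !mul1r.
have -> : X ^+ k.+2 - Y ^+ k.+2 =
    X *m (X ^+ k.+1 - Y ^+ k.+1) + (X - Y) *m Y ^+ k.+1.
  by rewrite !mulmxE mulrBr mulrBl -!exprS addrA subrK.
apply: le_trans (frobeniusD _ _) _.
have -> : k.+2%:R * M ^+ k.+1 * fro (X - Y) =
  M * (k.+1%:R * M ^+ k * fro (X - Y)) + fro (X - Y) * M ^+ k.+1.
  by rewrite -[k.+2]addn1 natrD exprS; ring.
apply: lerD; apply: le_trans (frobeniusM _ _) _.
  by apply: ler_pM; rewrite ?frobenius_ge0.
rewrite ler_wpM2l ?frobenius_ge0 //; apply: le_trans (frobenius_exprS _ _) _.
by rewrite lerXn2r ?nnegrE ?frobenius_ge0.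
Qed.

(** Telescoping bounds [X ^+ k - Y ^+ k] by [k * M ^+ k.-1 * fro (X - Y)], and
    dividing by the factorial of [k] gives back the exponential series of [M]. *)
Lemma expmx_lipschitz m (X Y : 'M[R[i]]_m) (M : R) : fro X <= M -> fro Y <= M ->
  fro (expmx X - expmx Y) <= expR M * fro (X - Y).
Proof.
move=> XM YM; have M0 : 0 <= M := le_trans (frobenius_ge0 _) XM.
apply: mx_cvg_bounded (mx_cvgB (expS_cvg X) (expS_cvg Y)) _ => -[|n].
  rewrite /expS /series /= !big_geq // subr0 frobenius0.
  by rewrite mulr_ge0 ?expR_ge0 ?frobenius_ge0.
rewrite /expS /series /= -sumrB !big_mkord big_ord_recl /= expr0 subrr add0r.
apply: le_trans (frobenius_sum _ _ _) _.
apply: (@le_trans _ _ (series (exp_coeff M) n * fro (X - Y))); last first.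
  by rewrite ler_wpM2r ?frobenius_ge0 // exp_coeff_partial_le.
rewrite /series /= big_mkord mulr_suml; apply: ler_sum => k _.
rewrite /bump /= add1n -scalerBr frobeniusZ normc_factV.
rewrite exp_coeffE; apply: le_trans (ler_wpM2l _ (frobenius_exprB _ XM YM)) _.
  by rewrite invr_ge0.
rewrite factS natrM invfM !mulrA ler_wpM2r ?frobenius_ge0 //.
by rewrite [X in X * M ^+ k <= _]mulrAC mulVf ?mul1r ?pnatr_eq0.
Qed.

Section Linear.
Context {m n : nat} (f : 'M[R[i]]_m -> 'M[R[i]]_n) (f_linear : linear f).

HB.instance Definition _ :=
  GRing.isLinear.Build R[i] 'M[R[i]]_m 'M[R[i]]_n _ f f_linear.

Lemma linear_mx_bounded : exists K : R, forall X, fro (f X) <= K * fro X.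
Proof.
exists (\sum_i \sum_j fro (f (delta_mx i j))) => X.
rewrite {1}(matrix_sum_delta X) linear_sum mulr_suml.
apply: le_trans (frobenius_sum _ _ _) _; apply: ler_sum => i _.
rewrite linear_sum mulr_suml.
apply: le_trans (frobenius_sum _ _ _) _; apply: ler_sum => j _.
by rewrite linearZ frobeniusZ mulrC ler_wpM2l ?frobenius_ge0 ?entry_le_frobenius.
Qed.

Lemma mx_cvg_linear u L : mx_cvg u L -> mx_cvg (fun k => f (u k)) (f L).
Proof.
move=> uL; have [K fK] := linear_mx_bounded.
by apply: mx_cvg_le (null_mulr K uL) => k; rewrite -linearB fK.
Qed.

(** A linear map may be moved inside the exponential series: this turns an
    identity between powers into one between exponentials. *)
Lemma linear_expmx_cvg (X : 'M[R[i]]_m) :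
  mx_cvg (series (fun k => (k`!%:R : R[i])^-1 *: f (X ^+ k))) (f (expmx X)).
Proof.
have := mx_cvg_linear (expS_cvg X); congr mx_cvg; apply/funext => k.
by rewrite /expS /series /= linear_sum; apply: eq_bigr => l _; rewrite linearZ.
Qed.

Lemma linear_expmx (X : 'M[R[i]]_m) (Y : 'M[R[i]]_n) :
  (forall k, f (X ^+ k) = Y ^+ k) -> f (expmx X) = expmx Y.
Proof.
move=> fX; apply: mx_cvg_unique (linear_expmx_cvg X) _.
by under eq_fun do rewrite fX; exact: expS_cvg.
Qed.

Lemma linear_expmxB (X : 'M[R[i]]_m) (Y Z : 'M[R[i]]_n) :
  (forall k, f (X ^+ k) = Y ^+ k - Z ^+ k) -> f (expmx X) = expmx Y - expmx Z.
Proof.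
move=> fX; apply: mx_cvg_unique (linear_expmx_cvg X) _.
have := mx_cvgB (expS_cvg Y) (expS_cvg Z); congr mx_cvg; apply/funext => k.
rewrite /expS /series /= -sumrB; apply: eq_bigr => l _.
by rewrite fX scalerBr.
Qed.

End Linear.
End Exponential.

(** * Reordering words in two matrices *)

Lemma normcD (R : realType) (x y : R[i]) : normc (x + y) <= normc x + normc y.
Proof. exact: le_normcD. Qed.

Lemma normcB (R : realType) (x y : R[i]) : normc (x - y) <= normc x + normc y.
Proof. by rewrite -(normcN y) normcD. Qed.

Lemma mxtrace_mulrC (R : comPzRingType) m (X Y : 'M[R]_m) :
  \tr (X * Y) = \tr (Y * X).
Proof. by rewrite -!mulmxE mxtrace_mulC. Qed.

Lemma count_true_false w : (count_mem true w + count_mem false w = size w)%N.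
Proof.
by rewrite -(count_predC (pred1 true) w); congr addn; apply: eq_count; case.
Qed.

Section Words.
Context {R : realType} {m : nat} (A B : 'M[R[i]]_m).

Definition word_mx (w : seq bool) : 'M[R[i]]_m :=
  \prod_(b <- w) (if b then A else B).

(** The product of the word [w] with its letters sorted, every [A] before every [B]. *)
Definition sorted_mx (w : seq bool) : 'M[R[i]]_m :=
  A ^+ count_mem true w * B ^+ count_mem false w.

Local Notation C := (commx A B).

Lemma commxE : C = A * B - B * A. Proof. by rewrite -mulmxE. Qed.

Lemma word_mx_cat u v : word_mx (u ++ v) = word_mx u * word_mx v.
Proof. exact: big_cat. Qed.

Lemma word_mx_cons b w : word_mx (b :: w) = (if b then A else B) * word_mx w.
Proof. exact: big_cons. Qed.

Lemma word_mx_rcons b w : word_mx (rcons w b) = word_mx w * (if b then A else B).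
Proof. by rewrite -cats1 word_mx_cat word_mx_cons /word_mx big_nil mulr1. Qed.

Lemma word_mx_nseq k b : word_mx (nseq k b) = (if b then A else B) ^+ k.
Proof.
elim: k => [|k IH]; first by rewrite /word_mx big_nil.
by rewrite word_mx_cons IH exprS.
Qed.

Section Reorder.
Variables (phi : 'M[R[i]]_m -> R[i]) (d : R) (K : nat).
Hypothesis phiB : {morph phi : X Y / X - Y}.
Hypothesis phi_comm : forall u v, (size u + size v <= K)%N ->
  normc (phi (word_mx u * C * word_mx v)) <= d.

(** Moving [B] across a power of [A] exchanges it with each factor [A] in turn. *)
Lemma reorder_power u v i : (size u + i + size v <= K.+1)%N ->
  normc (phi (word_mx u * A ^+ i * B * word_mx v)
    - phi (word_mx u * B * A ^+ i * word_mx v)) <= i%:R * d.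
Proof.
elim: i u => [|i IH] u size_le.
  by rewrite expr0 !mulr1 subrr normc0 mul0r.
pose X1 := word_mx u * A ^+ i.+1 * B * word_mx v.
pose X2 := word_mx u * A * B * A ^+ i * word_mx v.
pose X3 := word_mx u * B * A ^+ i.+1 * word_mx v.
have -> : phi X1 - phi X3 = (phi X1 - phi X2) + phi (X2 - X3).
  by rewrite phiB addrA subrK.
apply: le_trans (normcD _ _) _; rewrite -natr1 mulrDl mul1r; apply: lerD.
  have := IH (rcons u true); rewrite size_rcons addSnnS word_mx_rcons => /(_ size_le).
  by rewrite /X1 /X2 exprS !mulrA.
have -> : X2 - X3 = word_mx u * C * word_mx (nseq i true ++ v).
  rewrite word_mx_cat word_mx_nseq commxE /X2 /X3 exprS !mulrA.
  by rewrite mulrBr !mulrBl !mulrA.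
by apply: phi_comm; rewrite size_cat size_nseq addnA -ltnS -addSn -addnS.
Qed.

(** Sorting a word by adjacent exchanges uses at most one exchange per pair of
    letters, and each exchange inserts a commutator between two words. The bound is
    needed for two choices of [phi]: the trace against [C], and then the trace. *)
Lemma reorder_word u w : (size u + size w <= K.+1)%N ->
  normc (phi (word_mx u * word_mx w) - phi (word_mx u * sorted_mx w))
    <= (size w ^ 2)%:R * d.
Proof.
have d0 : 0 <= d.
  by apply: le_trans (phi_comm (u := [::]) (v := [::]) _); rewrite ?normc_ge0.
elim: w u => [|b w IH] u size_le.
  rewrite /word_mx /sorted_mx !big_nil /= !expr0 !mulr1 subrr.
  by rewrite normc0 mul0r.
have {}IH := IH (rcons u b); rewrite size_rcons addSnnS word_mx_rcons in IH.
have {IH} := IH size_le.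
rewrite word_mx_cons; case: b size_le => size_le IH.
  have -> : sorted_mx (true :: w) = A * sorted_mx w.
    by rewrite /sorted_mx /= add1n add0n exprS mulrA.
  rewrite !mulrA in IH *; apply: le_trans IH _.
  by rewrite ler_wpM2r // ler_nat leq_exp2r.
set i := count_mem true w; set j := count_mem false w.
have ij : (i + j = size w)%N by exact: count_true_false.
have Es : sorted_mx w = A ^+ i * word_mx (nseq j false) by rewrite word_mx_nseq.
have -> : sorted_mx (false :: w) = A ^+ i * B * word_mx (nseq j false).
  by rewrite /sorted_mx /= add0n add1n exprS mulrA word_mx_nseq.
have := @reorder_power u (nseq j false) i; rewrite size_nseq -addnA ij.
move=> /(_ (leq_trans (leq_add (leqnn _) (leqnSn _)) size_le)) reord.
rewrite Es !mulrA in IH reord *.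
set x := phi _ in IH *; set y := phi _ in IH reord; set z := phi _ in reord *.
have -> : x - z = (x - y) - (z - y) by rewrite opprB addrA subrK.
apply: le_trans (normcB _ _) _; apply: le_trans (lerD IH reord) _.
rewrite -mulrDl ler_wpM2r // -natrD ler_nat /= -!mulnn.
have : (i <= size w)%N by rewrite -ij leq_addr.
lia.
Qed.

Corollary reorder_sorted w : (size w <= K.+1)%N ->
  normc (phi (word_mx w) - phi (sorted_mx w)) <= (size w ^ 2)%:R * d.
Proof.
have := @reorder_word [::] w; rewrite add0n (_ : word_mx [::] = 1) ?mul1r //.
by rewrite /word_mx big_nil.
Qed.

End Reorder.

Hypotheses (A1 : fro A <= 1) (B1 : fro B <= 1).

Lemma frobenius_wordr w X : fro (X * word_mx w) <= fro X.
Proof.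
elim/last_ind: w => [|w b IH]; first by rewrite /word_mx big_nil mulr1.
rewrite word_mx_rcons mulrA -mulmxE; apply: le_trans (frobeniusM _ _) _.
rewrite mulmxE -[leRHS]mulr1; apply: ler_pM; rewrite ?frobenius_ge0 //.
by case: b.
Qed.

Lemma reorder_comm w :
  normc (\tr (C * word_mx w) - \tr (C * sorted_mx w)) <= (size w ^ 2)%:R * fro C ^+ 2.
Proof.
apply: (@reorder_sorted (fun X => \tr (C * X)) (fro C ^+ 2) (size w)) => //.
  by move=> X Y; rewrite mulrBr raddfB.
move=> u v _; rewrite !mulrA -[_ * _ * _ * _]mulrA -mulmxE.
apply: le_trans (normc_trM _ _) _; rewrite mulmxE expr2.
by apply: ler_pM; rewrite ?frobenius_ge0 ?frobenius_wordr.
Qed.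

(** Moving some of the letters [B] to the front of the word costs a second
    commutator each time. But the sum of the traces over all the positions of the
    commutator among [j.+1] letters [B] is the trace of [A ^+ i] times the commutator
    of [A] and [B ^+ j.+1], which is 0. So the trace on the left, which looks linear
    in the commutator, is an average of quadratic differences. *)
Lemma tr_comm_sorted i j :
  normc (\tr (C * (A ^+ i * B ^+ j))) <= ((i + j) ^ 2)%:R * fro C ^+ 2.
Proof.
set T := \tr _.
pose w l := nseq (j - l) false ++ nseq i true ++ nseq l false.
have sum0 : \sum_(l < j.+1) \tr (C * word_mx (w l)) = 0.
  have telescope : \sum_(l < j.+1) B ^+ l * C * B ^+ (j - l) =
      A * B ^+ j.+1 - B ^+ j.+1 * A.
    rewrite commxE; elim: {T w}j => [|j IH].
      by rewrite big_ord_recl big_ord0 addr0 subn0 expr0 expr1 mul1r mulr1.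
    rewrite big_ord_recr /= subnn expr0 mulr1.
    under eq_bigr => l _ do rewrite (subSn (leq_ord l)) exprSr mulrA.
    rewrite -mulr_suml IH !mulrBl mulrBr !exprSr !mulrA.
    by rewrite addrA subrK.
  transitivity (\tr (A ^+ i * (A * B ^+ j.+1 - B ^+ j.+1 * A))).
    rewrite -telescope mulr_sumr raddf_sum; apply: eq_bigr => l _ /=.
    by rewrite !word_mx_cat !word_mx_nseq !mulrA -[in LHS]mulrA
      mxtrace_mulrC !mulrA.
  by rewrite mulrBr raddfB /= !mulrA [X in _ - X]mxtrace_mulrC !mulrA -exprS
    -exprSr subrr.
have -> : T = (j.+1%:R)^-1 * \sum_(l < j.+1) (T - \tr (C * word_mx (w l))).
  rewrite sumrB sum0 subr0 sumr_const card_ord -[T *+ _]mulr_natl mulrA.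
  by rewrite mulVf ?mul1r ?pnatr_eq0.
rewrite normcM normcV.
rewrite -(rmorph_nat (@real_complex R)) normc_real ger0_norm //.
rewrite mulrC ler_pdivrMr ?ltr0n // mulr_natr.
apply: le_trans (normc_sum _ _ _) _.
rewrite -[X in _ <= _ *+ X]card_ord -sumr_const; apply: ler_sum => l _.
have lej : (l <= j)%N by rewrite -ltnS.
have -> : (i + j = size (w l))%N by rewrite !size_cat !size_nseq addnCA subnK // addnC.
have -> : T = \tr (C * sorted_mx (w l)).
  by rewrite /sorted_mx !count_cat !count_nseq /= !mul0n !mul1n add0n addn0 add0n subnK.
by rewrite -normcN opprB reorder_comm.
Qed.

Lemma tr_comm_word w :
  normc (\tr (C * word_mx w)) <= (2 * size w ^ 2)%:R * fro C ^+ 2.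
Proof.
rewrite -[X in normc X](subrK (\tr (C * sorted_mx w))).
apply: le_trans (normcD _ _) _; rewrite mul2n -addnn natrD [leRHS]mulrDl.
apply: lerD (reorder_comm w) _.
by rewrite -(count_true_false w); exact: tr_comm_sorted.
Qed.

(** Exchanging two letters inside a trace inserts one commutator, and
    [tr_comm_word] gains a second one, so reordering costs the square of
    the commutator. *)
Lemma tr_word_sorted w :
  normc (\tr (sorted_mx w) - \tr (word_mx w)) <= (2 * size w ^ 4)%:R * fro C ^+ 2.
Proof.
rewrite -normcN opprB.
apply: le_trans (_ : (size w ^ 2)%:R * ((2 * size w ^ 2)%:R * fro C ^+ 2) <= _).
  apply: (@reorder_sorted (@mxtrace _ m) _ (size w - 1)).
- by move=> X Y; rewrite raddfB.
- move=> u v uv.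
  rewrite mxtrace_mulrC mulrA mxtrace_mulrC -word_mx_cat.
  apply: le_trans (tr_comm_word _) _; rewrite size_cat addnC ler_wpM2r ?sqr_ge0 //.
  by rewrite ler_nat leq_mul2l leq_exp2r //= (leq_trans uv) // leq_subr.
- by rewrite subn1 leqSpred.
by rewrite mulrA -natrM mulnCA -expnD.
Qed.

Fixpoint words (k : nat) : seq (seq bool) :=
  if k is k'.+1 then map (cons true) (words k') ++ map (cons false) (words k')
  else [:: [::]].

Lemma size_words k : size (words k) = (2 ^ k)%N.
Proof. by elim: k => //= k IH; rewrite size_cat !size_map IH addnn -mul2n expnS. Qed.

Lemma size_in_words k w : w \in words k -> size w = k.
Proof.
elim: k w => [|k IH] w /=; first by rewrite inE => /eqP ->.
by rewrite mem_cat => /orP[] /mapP[u /IH <- ->].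
Qed.

Lemma exprD_words k : (A + B) ^+ k = \sum_(w <- words k) word_mx w.
Proof.
elim: k => [|k IH]; first by rewrite big_seq1 /word_mx big_nil.
rewrite exprS IH mulrDl big_cat !big_map /= !mulr_sumr.
by congr (_ + _); apply: eq_bigr => w _; rewrite word_mx_cons.
Qed.

End Words.

(** * Ordered exponential and Cauchy product *)

Lemma triangle_sum (V : nmodType) (g : nat -> nat -> V) N :
  \sum_(k < N) \sum_(i < k.+1) g i (k - i)%N =
  \sum_(i < N) \sum_(j < N | (i + j < N)%N) g i j.
Proof.
transitivity (\sum_(k < N) \sum_(i < N | (i <= k)%N) g i (k - i)%N).
  apply: eq_bigr => k _.
  by rewrite (big_ord_widen _ (fun i => g i (k - i)%N) (ltn_ord k)).
rewrite (exchange_big_dep xpredT) //=; apply: eq_bigr => i _.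
transitivity (\sum_(i <= k < N) g i (k - i)%N); first by rewrite big_geq_mkord.
rewrite -{1}[nat_of_ord i]add0n big_addn big_mkord.
rewrite (big_ord_widen_cond _ xpredT (fun j => g i (j + i - i)%N) (leq_subr i N)).
by apply: eq_big => [j|j _]; rewrite ?ltn_subRL ?addnK.
Qed.

Lemma Cauchy_product_gap (V : pzRingType) (f g : nat -> V) N :
  (\sum_(i < N) f i) * (\sum_(j < N) g j)
    - \sum_(k < N) \sum_(i < k.+1) f i * g (k - i)%N =
  \sum_(i < N) \sum_(j < N | (N <= i + j)%N) f i * g j.
Proof.
rewrite (triangle_sum (fun i j => f i * g j)) mulr_suml -sumrB.
apply: eq_bigr => i _; rewrite mulr_sumr.
rewrite (bigID (fun j : 'I_N => (i + j < N)%N)) /= addrAC subrr add0r.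
by apply: eq_bigl => j; rewrite -leqNgt.
Qed.

Section NormalOrder.
Context {R : realType} {m : nat}.
Implicit Types A B : 'M[R[i]]_m.

Lemma mxscaleAl (a : R[i]) A B : a *: (A * B) = (a *: A) * B.
Proof. by rewrite -!mulmxE scalemxAl. Qed.

Lemma mxscaleAr (a : R[i]) A B : a *: (A * B) = A * (a *: B).
Proof. by rewrite -!mulmxE scalemxAr. Qed.

Definition expterm (X : 'M[R[i]]_m) k := (k`!%:R : R[i])^-1 *: X ^+ k.

(** The part of order [k] of the product of the exponential series. *)
Definition ordered_term A B k := \sum_(i < k.+1) expterm A i * expterm B (k - i)%N.

(** The expansion of [(A + B) ^+ k] into words, with each word sorted. *)
Definition ordered_sum A B k := \sum_(w <- words k) sorted_mx A B w.

Lemma ordered_sumS A B k :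
  ordered_sum A B k.+1 = A * ordered_sum A B k + ordered_sum A B k * B.
Proof.
rewrite /ordered_sum /= big_cat !big_map /= mulr_sumr mulr_suml.
congr (_ + _); apply: eq_bigr => w _; rewrite /sorted_mx /=.
  by rewrite add1n add0n exprS mulrA.
by rewrite add1n add0n exprSr mulrA.
Qed.

Lemma expterm_mull (X : 'M[R[i]]_m) k : X * expterm X k = k.+1%:R *: expterm X k.+1.
Proof.
rewrite /expterm -mxscaleAr -exprS scalerA factS natrM invfM mulrA.
by rewrite divff ?mul1r ?pnatr_eq0.
Qed.

Lemma expterm_mulr (X : 'M[R[i]]_m) k : expterm X k * X = k.+1%:R *: expterm X k.+1.
Proof. by rewrite -expterm_mull /expterm -mxscaleAl -mxscaleAr -exprSr -exprS. Qed.

Lemma ordered_termS A B k :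
  k.+1%:R *: ordered_term A B k.+1 = A * ordered_term A B k + ordered_term A B k * B.
Proof.
rewrite /ordered_term scaler_sumr mulr_sumr mulr_suml.
transitivity (\sum_(i < k.+2) i%:R *: (expterm A i * expterm B (k.+1 - i)%N) +
    \sum_(i < k.+2) (k.+1 - i)%:R *: (expterm A i * expterm B (k.+1 - i)%N)).
  rewrite -big_split; apply: eq_bigr => i _ /=.
  by rewrite -scalerDl -natrD subnKC // -ltnS.
congr (_ + _).
  rewrite big_ord_recl scale0r add0r; apply: eq_bigr => i _.
  by rewrite /= /bump /= add1n subSS mulrA expterm_mull mxscaleAl.
rewrite big_ord_recr /= subnn scale0r addr0; apply: eq_bigr => i _.
by rewrite (subSn (leq_ord i)) -mulrA expterm_mulr mxscaleAr.
Qed.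

(** Both sides satisfy the recursion of [ordered_sumS], up to the factor [k.+1]. *)
Lemma ordered_termE A B k : ordered_term A B k = (k`!%:R : R[i])^-1 *: ordered_sum A B k.
Proof.
elim: k => [|k IH].
  rewrite /ordered_term /ordered_sum big_ord1 big_seq1 /sorted_mx /expterm /=.
  by rewrite !expr0 !fact0 invr1 !scale1r mulr1.
have k0 : (k.+1%:R : R[i]) != 0 by rewrite pnatr_eq0.
apply: (scalerI k0); rewrite ordered_termS IH ordered_sumS.
rewrite -mxscaleAl -mxscaleAr -scalerDr scalerA; congr (_ *: _).
by rewrite factS natrM invfM mulrA divff ?mul1r.
Qed.

Lemma exp_coeffD (a b : R) k :
  exp_coeff (a + b) k = \sum_(i < k.+1) exp_coeff a i * exp_coeff b (k - i)%N.
Proof.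
rewrite /exp_coeff /= [a + b]addrC exprDn mulr_suml; apply: eq_bigr => i _ /=.
have ik : (i <= k)%N by rewrite -ltnS.
rewrite -mulr_natl mulrAC -{1}(bin_fact ik) !natrM !invfM.
rewrite !mulrA divff ?mul1r ?pnatr_eq0 -?lt0n ?bin_gt0 //.
ring.
Qed.

Lemma frobenius_exptermM A B i j : (0 < i + j)%N ->
  fro (expterm A i * expterm B j) <= exp_coeff (fro A) i * exp_coeff (fro B) j.
Proof.
have le_term (X : 'M[R[i]]_m) k : fro (expterm X k.+1) <= exp_coeff (fro X) k.+1.
  rewrite frobeniusZ normc_factV /exp_coeff /= mulrC.
  by rewrite ler_wpM2r ?invr_ge0 // frobenius_exprS.
have term0 (X : 'M[R[i]]_m) : expterm X 0 = 1.
  by rewrite /expterm expr0 fact0 invr1 scale1r.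
have coeff0 (x : R) : exp_coeff x 0 = 1 by rewrite /exp_coeff /= expr0 fact0 divr1.
case: i j => [|i] [|j] // _; rewrite ?term0 ?coeff0 ?mul1r ?mulr1 ?le_term //.
rewrite -mulmxE; apply: le_trans (frobeniusM _ _) _.
by apply: ler_pM; rewrite ?frobenius_ge0.
Qed.

(** The part of the double series that is missing on the left is dominated
    by the corresponding part for the numbers [fro A] and [fro B], which
    vanishes in the limit by the addition formula of the real exponential. *)
Lemma expmxM_cvg A B :
  mx_cvg (fun N => \sum_(k < N) ordered_term A B k) (expmx A *m expmx B).
Proof.
pose a := fro A; pose b := fro B.
pose gap N := series (exp_coeff a) N * series (exp_coeff b) N
  - series (exp_coeff (a + b)) N.
have gap0 : gap @ \oo --> (0 : R).
  have := cvgB (cvgM (is_cvg_series_exp_coeff a) (is_cvg_series_exp_coeff b))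
    (is_cvg_series_exp_coeff (a + b)).
  rewrite -/(expR a) -/(expR b) -/(expR (a + b)) expRD subrr; exact.
apply: mx_cvg_close (mx_cvgM (expS_cvg A) (expS_cvg B)) _ gap0 => -[|N].
  rewrite big_ord0 /expS /gap /series /= !big_geq // mul0mx subr0 frobenius0.
  by rewrite mulr0 subr0.
rewrite -frobeniusN opprB /gap.
have -> : series (exp_coeff (a + b)) N.+1 =
    \sum_(k < N.+1) \sum_(i < k.+1) exp_coeff a i * exp_coeff b (k - i)%N.
  by rewrite /series /= big_mkord; apply: eq_bigr => k _; exact: exp_coeffD.
rewrite /expS /series /= !big_mkord Cauchy_product_gap Cauchy_product_gap.
apply: le_trans (frobenius_sum _ _ _) _; apply: ler_sum => i _.
apply: le_trans (frobenius_sum _ _ _) _; apply: ler_sum => j ij.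
by apply: frobenius_exptermM; apply: leq_trans ij.
Qed.

End NormalOrder.

(** * Bounds for the Golden--Thompson gap of two matrices *)

Section Defect.
Context {R : realType} {m : nat}.
Implicit Types A B X Y : 'M[R[i]]_m.

(** GT stands for Golden--Thompson. *)
Definition GT_gap A B : R[i] := \tr (expmx A *m expmx B) - \tr (expmx (A + B)).

(** The part of order [k] of the gap, multiplied by the factorial of [k]. *)
Definition GT_coeff A B k : R[i] := \tr (ordered_sum A B k) - \tr ((A + B) ^+ k).

Lemma GT_coeff_words A B k : GT_coeff A B k =
  \sum_(w <- words k) (\tr (sorted_mx A B w) - \tr (word_mx A B w)).
Proof.
by rewrite sumrB /GT_coeff /ordered_sum exprD_words -2!(raddf_sum (@mxtrace _ m)).
Qed.

Lemma GT_gap_cvg A B :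
  (fun N => normc (\sum_(k < N) (k`!%:R)^-1 * GT_coeff A B k - GT_gap A B))
    @ \oo --> (0 : R).
Proof.
have := mx_cvg_tr (mx_cvgB (expmxM_cvg A B) (expS_cvg (A + B))).
rewrite [X in X @ _ --> _](_ : _ =
  fun N => normc (\sum_(k < N) (k`!%:R)^-1 * GT_coeff A B k - GT_gap A B)) //.
apply/funext => N; rewrite /GT_gap; congr (normc (_ - _)); last by rewrite raddfB.
rewrite /expS /series /= big_mkord -sumrB raddf_sum; apply: eq_bigr => k _ /=.
by rewrite ordered_termE -scalerBr mxtraceZ raddfB.
Qed.

(** Bounds pass from the partial sums of the gap to the gap; starting at [N0] terms
    allows [c] to be the leading term. *)
Lemma GT_gap_close A B (c : R[i]) (b : R) N0 :
  (forall N, normc (\sum_(k < N0 + N) (k`!%:R)^-1 * GT_coeff A B k - c) <= b) ->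
  normc (GT_gap A B - c) <= b.
Proof.
move=> Hb; rewrite -subr_le0.
have := GT_gap_cvg A B; rewrite -(cvg_shiftn N0) => cvg0.
rewrite -(cvg_lim _ cvg0) //; apply: limr_ge; first by apply/cvg_ex; exists 0.
apply: nearW => N /=; rewrite lerBlDr addnC.
set s := \sum_(k < _) _; rewrite -[GT_gap A B - c](subrKA s).
apply: le_trans (normcD _ _) _; rewrite -normcN opprB lerD2l.
exact: Hb.
Qed.

(** There are [2 ^ k] words, each contributing at most [2 * k ^ 4], and [k <= 2 ^ k]. *)
Lemma GT_coeff_le1 A B k : fro A <= 1 -> fro B <= 1 ->
  normc (GT_coeff A B k) <= 2 * 32 ^+ k * fro (commx A B) ^+ 2.
Proof.
move=> A1 B1; rewrite GT_coeff_words.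
apply: le_trans (normc_sum _ _ _) _.
apply: le_trans (_ : \sum_(w <- words k) (2 * k ^ 4)%:R * fro (commx A B) ^+ 2 <= _).
  rewrite big_seq [leRHS]big_seq; apply: ler_sum => w /size_in_words <-.
  exact: tr_word_sorted.
rewrite big_const_seq count_predT size_words iter_addr_0 -[_ *+ (2 ^ k)]mulr_natl mulrA.
rewrite ler_wpM2r ?sqr_ge0 // -natrM -natrX -natrM ler_nat.
rewrite mulnCA leq_mul2l /= -[32%N]/(2 * 2 ^ 4)%N expnMn leq_mul2l expn_eq0 /=.
by rewrite -expnM mulnC expnM leq_exp2r // ltnW // ltn_expl.
Qed.

Lemma GT_coeffZ (t : R[i]) A B k : GT_coeff (t *: A) (t *: B) k = t ^+ k * GT_coeff A B k.
Proof.
rewrite !GT_coeff_words mulr_sumr big_seq [RHS]big_seq; apply: eq_bigr => w.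
move=> /size_in_words sw.
have exprZ X l : (t *: X) ^+ l = t ^+ l *: X ^+ l.
  elim: l => [|l IH]; first by rewrite !expr0 scale1r.
  by rewrite !exprS IH -mxscaleAl -mxscaleAr scalerA.
have -> : sorted_mx (t *: A) (t *: B) w = t ^+ k *: sorted_mx A B w.
  rewrite /sorted_mx !exprZ -mxscaleAl -mxscaleAr scalerA -exprD; congr (_ ^+ _ *: _).
  by rewrite -sw count_true_false.
have -> : word_mx (t *: A) (t *: B) w = t ^+ k *: word_mx A B w.
  rewrite -sw; elim: w {sw} => [|b w IH].
    by rewrite /word_mx !big_nil expr0 scale1r.
  rewrite !word_mx_cons IH exprS -mxscaleAr -[in RHS]scalerA.
  rewrite [in RHS]scalerA mulrC -scalerA.
  by case: b; rewrite -mxscaleAl.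
by rewrite !mxtraceZ mulrBr.
Qed.

Lemma commxZ (t : R[i]) A B : commx (t *: A) (t *: B) = t ^+ 2 *: commx A B.
Proof.
by rewrite /commx -!scalemxAl -!scalemxAr !scalerA -expr2 -scalerBr.
Qed.

(** The coefficient is homogeneous of degree [k] and the squared commutator of
    degree 4, hence the power of [M] when the unit ball is rescaled. *)
Lemma GT_coeff_le A B (M : R) k : 0 < M -> fro A <= M -> fro B <= M ->
  M ^+ 4 * normc (GT_coeff A B k) <= 2 * (32 * M) ^+ k * fro (commx A B) ^+ 2.
Proof.
move=> M0 AM BM.
have nMV : normc (M^-1)%:C = M^-1.
  by rewrite normc_real ger0_norm // invr_ge0 ltW.
have normcX (z : R[i]) l : normc (z ^+ l) = normc z ^+ l.
  elim: l => [|l IH]; first by rewrite !expr0 normc1.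
  by rewrite !exprS normcM IH.
have fro1 X : fro X <= M -> fro ((M^-1)%:C *: X) <= 1.
  by move=> XM; rewrite frobeniusZ nMV mulrC ler_pdivrMr // mul1r.
have := GT_coeff_le1 k (fro1 _ AM) (fro1 _ BM).
rewrite GT_coeffZ commxZ frobeniusZ normcM !normcX nMV.
rewrite !exprVn exprMn exprVn -exprM mulrCA [X in X <= _]mulrC.
rewrite ler_pdivrMr ?exprn_gt0 // => H.
rewrite mulrC -ler_pdivlMr ?exprn_gt0 //; apply: le_trans H _.
by rewrite exprMn -!mulrA le_eqVlt; apply/orP; left; apply/eqP; ring.
Qed.

Lemma GT_partial_sum_le A B (M : R) N : 1 <= M -> fro A <= M -> fro B <= M ->
  normc (\sum_(k < N) (k`!%:R)^-1 * GT_coeff A B k) <=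
  2 * expR (32 * M) * fro (commx A B) ^+ 2.
Proof.
move=> M1 AM BM; have M0 : 0 < M := lt_le_trans ltr01 M1.
apply: le_trans (normc_sum _ _ _) _.
apply: le_trans (_ : 2 * series (exp_coeff (32 * M)) N * fro (commx A B) ^+ 2 <= _).
  rewrite /series /= big_mkord mulr_sumr mulr_suml; apply: ler_sum => k _.
  rewrite normcM normc_factV mulrC ler_pdivrMr ?ltr0n ?fact_gt0 //.
  rewrite /exp_coeff /=.
  have -> : 2 * ((32 * M) ^+ k / k`!%:R) * fro (commx A B) ^+ 2 * k`!%:R =
     2 * (32 * M) ^+ k * fro (commx A B) ^+ 2.
    by field; rewrite pnatr_eq0 -lt0n fact_gt0.
  apply: le_trans (GT_coeff_le k M0 AM BM).
  by rewrite ler_peMl ?normc_ge0 // exprn_ege1.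
rewrite ler_wpM2r ?sqr_ge0 // ler_wpM2l // exp_coeff_partial_le //.
by rewrite mulr_ge0 // ltW.
Qed.

Lemma GT_gap_le A B (M : R) : 1 <= M -> fro A <= M -> fro B <= M ->
  normc (GT_gap A B) <= 2 * expR (32 * M) * fro (commx A B) ^+ 2.
Proof.
move=> M1 AM BM; rewrite -[GT_gap A B]subr0; apply: (@GT_gap_close _ _ _ _ 0) => N.
by rewrite subr0; exact: GT_partial_sum_le.
Qed.

Lemma Im_GT_gap A B : (forall k, complex.Im (GT_coeff A B k) = 0) ->
  complex.Im (GT_gap A B) = 0.
Proof.
move=> H; apply/eqP; rewrite -normr_eq0 eq_le normr_ge0 andbT -subr_le0 subr0.
rewrite -(cvg_lim _ (GT_gap_cvg A B)) //; apply: limr_ge.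
  by apply/cvg_ex; exists 0; exact: GT_gap_cvg.
apply: nearW => N; apply: le_trans (Im_le_normc _).
move: (GT_gap A B) => g; rewrite raddfB /= raddf_sum /=.
rewrite big1 ?sub0r ?normrN // => k _; move: (H k).
rewrite -(rmorph_nat (@real_complex R)) -fmorphV.
by case: GT_coeff => a b /= ->; rewrite mul0r mulr0 addr0.
Qed.

End Defect.

(** * Hermitian matrices *)

Section Hermitian.
Context {R : realType} {m : nat}.
Implicit Types A B X Y : 'M[R[i]]_m.

Lemma adjmxM X Y : (X * Y)^t* = Y^t* * X^t*.
Proof. by rewrite -!mulmxE trmx_mul map_mxM. Qed.

Lemma adjmxX X k : (X ^+ k)^t* = X^t* ^+ k.
Proof.
elim: k => [|k IH]; first by rewrite !expr0 trmx1 map_mx1.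
by rewrite exprS exprSr adjmxM IH.
Qed.

Lemma adjmxD X Y : (X + Y)^t* = X^t* + Y^t*.
Proof. by rewrite linearD map_mxD. Qed.

Lemma mxtrace_adj X : \tr (X^t*) = (\tr X)^*.
Proof. by rewrite trace_map_mx mxtrace_tr. Qed.

Lemma Im_tr_selfadj X : \tr (X^t*) = \tr X -> complex.Im (\tr X) = 0.
Proof.
rewrite mxtrace_adj; case: (\tr X) => a b /eqP.
rewrite eq_complex /= eqxx /= -subr_eq0 -opprD oppr_eq0 -mulr2n mulrn_eq0 /=.
by move/eqP.
Qed.

Lemma sqr_frobenius_tr X : (fro X ^+ 2)%:C = \tr (X^t* * X).
Proof.
rewrite sqr_frobenius exchange_big raddf_sum -mulmxE; apply: eq_bigr => j _ /=.
rewrite mxE raddf_sum; apply: eq_bigr => i _ /=.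
by rewrite !mxE rmorphXn /= normc_norm normCK mulrC.
Qed.

Lemma Im_GT_coeff A B k : A^t* = A -> B^t* = B -> complex.Im (GT_coeff A B k) = 0.
Proof.
move=> hA hB; rewrite /GT_coeff raddfB /= (Im_tr_selfadj (X := (A + B) ^+ k)); last first.
  by rewrite adjmxX adjmxD hA hB.
rewrite subr0 /ordered_sum (raddf_sum (@mxtrace _ m)) raddf_sum big1 // => w _.
apply: Im_tr_selfadj.
rewrite /sorted_mx.
rewrite adjmxM.
rewrite adjmxX.
rewrite adjmxX.
rewrite hA.
rewrite hB.
exact: mxtrace_mulrC.
Qed.

Lemma mxtrace_word_rot A B w k :
  \tr (word_mx A B (rot k w)) = \tr (word_mx A B w).
Proof.
by rewrite /rot word_mx_cat mxtrace_mulrC -word_mx_cat cat_take_drop.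
Qed.

Lemma sorted_mxE A B w : sorted_mx A B w =
  word_mx A B (nseq (count_mem true w) true ++ nseq (count_mem false w) false).
Proof. by rewrite word_mx_cat !word_mx_nseq. Qed.

(** A word of length at most 3 has at most one letter of some kind, so it is a rotation
    of its sorted form and has the same trace. *)
Lemma GT_coeff_lt4 A B k : (k < 4)%N -> GT_coeff A B k = 0.
Proof.
pose f w := \tr (word_mx A B w).
have r k' w : f (rot k' w) = f w by exact: mxtrace_word_rot.
rewrite GT_coeff_words.
case: k => [|[|[|[|//]]]] _ /=; rewrite !big_cons big_nil !sorted_mxE /= -!/(f _).
- ring.
- ring.
- rewrite -[f [:: false; true]](r 1%N) /rot /=; ring.
- rewrite -[f [:: true; false; true]](r 2%N) -[f [:: false; true; true]](r 1%N).
  rewrite -[f [:: false; true; false]](r 1%N).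
  rewrite -[f [:: false; false; true]](r 2%N).
  rewrite /rot /=; ring.
Qed.

(** The only words of length 4 that are not rotations of their sorted forms are the two
    alternating ones, and they appear in the trace of the squared commutator too. *)
Lemma GT_coeff4 A B : A^t* = A -> B^t* = B -> GT_coeff A B 4 = (fro (commx A B) ^+ 2)%:C.
Proof.
move=> hA hB; pose f w := \tr (word_mx A B w).
have r k' w : f (rot k' w) = f w by exact: mxtrace_word_rot.
have -> : (fro (commx A B) ^+ 2)%:C =
    2 * (f [:: true; true; false; false] - f [:: true; false; true; false]).
  rewrite sqr_frobenius_tr.
  have -> : (commx A B)^t* = - commx A B.
    by rewrite commxE linearB map_mxB !adjmxM hA hB opprB.
  have -> : commx A B = word_mx A B [:: true; false] - word_mx A B [:: false; true].
    by rewrite commxE !word_mx_cons /word_mx !big_nil !mulr1.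
  rewrite mulNr mulrBr !mulrBl -!word_mx_cat /=.
  rewrite linearN /= !(linearB (@mxtrace _ m)) /= -!/(f _).
  rewrite -[f [:: false; true; true; false]](r 1%N).
  rewrite -[f [:: true; false; false; true]](r 3%N).
  rewrite -[f [:: false; true; false; true]](r 1%N).
  by rewrite /rot /=; ring.
rewrite GT_coeff_words /= !big_cons big_nil !sorted_mxE /= -!/(f _).
rewrite -[f [:: true; true; false; true]](r 3%N).
rewrite -[f [:: true; false; true; true]](r 2%N).
rewrite -[f [:: false; true; true; true]](r 1%N).
rewrite -[f [:: true; false; false; true]](r 3%N).
rewrite -[f [:: false; true; true; false]](r 1%N).
rewrite -[f [:: false; false; true; true]](r 2%N).
rewrite -[f [:: false; true; false; true]](r 1%N).
rewrite -[f [:: false; true; false; false]](r 1%N).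
rewrite -[f [:: false; false; true; false]](r 2%N).
rewrite -[f [:: false; false; false; true]](r 3%N).
rewrite /rot /=; ring.
Qed.

Lemma real_complex_close (z : R[i]) (a b : R) : complex.Im z = 0 -> normc (z - a%:C) <= b ->
  (a - b)%:C <= z <= (a + b)%:C.
Proof.
move=> Imz /(le_trans (Re_le_normc _)).
rewrite raddfB /= ler_distl => /andP[H1 H2].
by rewrite !lecE /= Imz eqxx H1 H2.
Qed.

Lemma GT_gap_herm_le A B (M : R) : A^t* = A -> B^t* = B ->
  1 <= M -> fro A <= M -> fro B <= M ->
  - (2 * expR (32 * M) * fro (commx A B) ^+ 2)%:C <= GT_gap A B
    <= (2 * expR (32 * M) * fro (commx A B) ^+ 2)%:C.
Proof.
move=> hA hB M1 AM BM.
have := @real_complex_close (GT_gap A B) 0 _ _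
  (_ : _ <= 2 * expR (32 * M) * fro (commx A B) ^+ 2).
rewrite sub0r add0r rmorphN; apply; last by rewrite subr0 GT_gap_le.
by apply: Im_GT_gap => k; exact: Im_GT_coeff.
Qed.

(** The solution of [2 * small_radius * expR 32 = 1 / 48]: half of the coefficient
    [1 / 24] of the leading term is left for the terms of order five and more. *)
Definition small_radius : R := expR (- 32) / 96.

Lemma small_radius_gt0 : 0 < small_radius.
Proof. by rewrite divr_gt0 ?expR_gt0. Qed.

Lemma small_radius_le1 : small_radius <= 1.
Proof.
rewrite ler_pdivrMr // mul1r; apply: (@le_trans _ _ 1); last lra.
by rewrite expR_le1; lra.
Qed.

(** The terms of order five and more carry an extra factor [small_radius], which keeps
    them below half of the leading term. *)
Lemma GT_gap_small A B : A^t* = A -> B^t* = B ->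
  fro A <= small_radius -> fro B <= small_radius ->
  (fro (commx A B) ^+ 2 / 48)%:C <= GT_gap A B <= (fro (commx A B) ^+ 2 / 12)%:C.
Proof.
move=> hA hB Ae Be; set c2 := fro _ ^+ 2.
have e0 := small_radius_gt0; have e1 := small_radius_le1.
have c20 : 0 <= c2 by rewrite sqr_ge0.
have ImG : complex.Im (GT_gap A B) = 0.
  by apply: Im_GT_gap => k; exact: Im_GT_coeff.
suff H : normc (GT_gap A B - (c2 / 24)%:C) <= c2 / 48.
  have := real_complex_close ImG H.
  have -> : c2 / 24 - c2 / 48 = c2 / 48 by field.
  move=> /andP[-> H2] /=; apply: le_trans H2 _; rewrite lecR; lra.
apply: (@GT_gap_close _ _ _ _ _ _ 5) => N.
rewrite big_split_ord /= big_ord_recr /= big1 ?add0r => [|k _]; last first.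
  by rewrite GT_coeff_lt4 ?mulr0 // ltn_ord.
rewrite GT_coeff4 // -/c2.
have -> : (4`!%:R)^-1 * c2%:C = (c2 / 24)%:C :> R[i].
  by rewrite mulrC -(rmorph_nat (@real_complex R)) -fmorphV -rmorphM.
rewrite addrAC subrr add0r; apply: le_trans (normc_sum _ _ _) _.
apply: (@le_trans _ _
  (2 * small_radius * series (exp_coeff 32) (5 + N) * c2)); last first.
  rewrite ler_pdivlMr // (_ : c2 = 1 * c2) ?mul1r //.
  (* [small_radius] makes this intermediate bound equal to [c2] *)
  apply: (@le_trans _ _ (2 * small_radius * expR 32 * c2 * 48)).
    rewrite !ler_wpM2r // ler_wpM2l ?mulr_ge0 ?(ltW e0) // exp_coeff_partial_le //.
  rewrite /small_radius expRN.
  have := @expR_gt0 R 32 => E.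
  rewrite le_eqVlt; apply/orP; left; apply/eqP; field.
  by rewrite gt_eqF.
rewrite /series /= big_mkord big_split_ord /= mulrDr mulrDl.
apply: (@le_trans _ _
  (2 * small_radius * (\sum_(i < N) exp_coeff 32 (5 + i)%N) * c2)); last first.
  rewrite lerDr mulr_ge0 // mulr_ge0 ?mulr_ge0 ?(ltW e0) //.
  by apply: sumr_ge0 => i _; exact: exp_coeff_ge0.
rewrite mulr_sumr mulr_suml; apply: ler_sum => k _.
rewrite normcM normc_factV mulrC ler_pdivrMr ?ltr0n ?fact_gt0 //.
have /= H := GT_coeff_le (5 + k) e0 Ae Be.
rewrite -(ler_pM2l (exprn_gt0 4 e0)); apply: le_trans H _; rewrite -/c2.
rewrite /exp_coeff /=.
set F : R := (5 + k)`!%:R; have F0 : F != 0 by rewrite pnatr_eq0 -lt0n fact_gt0.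
have -> : small_radius ^+ 4 * (2 * small_radius * (32 ^+ (5 + k) / F) * c2 * F)
  = (2 * 32 ^+ (5 + k) * c2) * small_radius ^+ 5 by field.
have -> : 2 * (32 * small_radius) ^+ (5 + k) * c2 =
  (2 * 32 ^+ (5 + k) * c2) * small_radius ^+ (5 + k) by rewrite exprMn; ring.
apply: ler_wpM2l; first by rewrite mulr_ge0 // mulr_ge0 // exprn_ge0.
by rewrite exprD ler_piMr ?exprn_ge0 ?exprn_ile1 ?(ltW e0).
Qed.

End Hermitian.

(** * The defect of tensors *)

Section TensorDefect.
Context {R : realType} {n p : nat}.
Implicit Types (Phi : 'M[R[i]]_p) (A B : tensor R n p).

Lemma mxdiagX (D : 'I_p -> 'M[R[i]]_n) k :
  (\mxdiag_(w < p) D w) ^+ k = \mxdiag_(w < p) (D w ^+ k).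
Proof.
elim: k => [|k IH].
  rewrite expr0 -[RHS]/(\mxdiag_(w < p) (1%:M : 'M[R[i]]_n)).
  by rewrite mxdiagZ.
rewrite exprS IH -mulmxE [X in _ *m X]/mxdiag mul_mxdiag_mxblock.
apply: eq_mxblock => i j; have [_|_] := eqVneq i j; last by rewrite mulmx0.
by rewrite !conform_mx_id exprS.
Qed.

Lemma submxblock_expmx (D : 'I_p -> 'M[R[i]]_n) w :
  submxblock (expmx (\mxdiag_(w < p) D w)) w w = expmx (D w).
Proof.
apply: (linear_expmx (f := fun M => submxblock M w w)) => [a X Y|k].
  by rewrite submxblockD; congr (_ + _); apply/matrixP => i j; rewrite !mxE.
by rewrite mxdiagX submxblock_diag.
Qed.

Lemma slice_tunlift Phi M w : Phi \is unitarymx ->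
  slice Phi (tunlift Phi M) w = submxblock M w w :> 'M[R[i]]_n.
Proof.
move=> U; have := tunliftK (fun v => submxblock M v v) U.
move=> /(congr1 (fun M => submxblock M w w)); rewrite !submxblock_diag => <-.
congr (slice Phi _ w); apply/ffunP => k; rewrite !ffunE.
by apply: eq_bigr => v _; rewrite submxblock_diag.
Qed.

Lemma slice_texp Phi A w : Phi \is unitarymx ->
  slice Phi (texp Phi A) w = expmx (slice Phi A w).
Proof. by move=> U; rewrite /texp slice_tunlift // submxblock_expmx. Qed.

Lemma slice_tplus Phi A B w : Phi \is unitarymx ->
  slice Phi (tplus Phi A B) w = slice Phi A w + slice Phi B w.
Proof. by move=> U; rewrite /tplus slice_tunlift // submxblockD !submxblock_diag. Qed.

Lemma slice_tstar Phi A B w : Phi \is unitarymx ->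
  slice Phi (tstar Phi A B) w = slice Phi A w *m slice Phi B w.
Proof.
move=> U; rewrite /tstar slice_tunlift //.
rewrite /tlift [X in _ *m X]/mxdiag mul_mxdiag_mxblock mxblockK eqxx.
by rewrite conform_mx_id.
Qed.

Lemma defectE Phi A B : Phi \is unitarymx ->
  defect Phi A B = \sum_w GT_gap (slice Phi A w) (slice Phi B w).
Proof.
move=> U; have trE X : ttrace Phi X = \sum_w \tr (slice Phi X w) :> R[i].
  exact: mxtrace_mxdiag.
rewrite /defect !trE -sumrB; apply: eq_bigr => w _.
have E1 : slice Phi (tstar Phi (texp Phi A) (texp Phi B)) w =
    expmx (slice Phi A w) *m expmx (slice Phi B w).
  exact: etrans (slice_tstar _ _ _ U)
    (congr2 mulmx (slice_texp _ _ U) (slice_texp _ _ U)).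
have E2 : slice Phi (texp Phi (tplus Phi A B)) w =
    expmx (slice Phi A w + slice Phi B w).
  exact: etrans (slice_texp _ _ U) (congr1 expmx (slice_tplus _ _ _ U)).
exact: (congr2 (fun X Y => \tr X - \tr Y) E1 E2).
Qed.

Lemma adjmx_mxdiag (D : 'I_p -> 'M[R[i]]_n) :
  (\mxdiag_(w < p) D w)^t* = \mxdiag_(w < p) (D w)^t*.
Proof.
rewrite tr_mxdiag; apply/mxblockP => v w.
transitivity (map_mx Num.conj (submxblock (\mxdiag_(w < p) (D w)^T) v w)).
  by apply/matrixP => i j; rewrite !mxE.
rewrite /mxdiag !mxblockK; have [_|_] := eqVneq v w; last by rewrite map_mx0.
by rewrite !conform_mx_id.
Qed.

Lemma thermitianP Phi A :
  thermitian Phi A <-> forall w, (slice Phi A w)^t* = slice Phi A w.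
Proof.
rewrite /thermitian; split => [/is_hermitianmxP|H].
  rewrite expr0 scale1r /tlift adjmx_mxdiag => E w.
  by have := congr1 (fun M => submxblock M w w) E; rewrite !submxblock_diag.
by apply/is_hermitianmxP; rewrite expr0 scale1r /tlift adjmx_mxdiag; apply: eq_mxdiag.
Qed.

Lemma sum_row_unitary Phi w : Phi \is unitarymx -> \sum_k normc (Phi w k) ^+ 2 = 1.
Proof.
move=> /unitarymxP /matrixP /(_ w w); rewrite !mxE eqxx => E.
apply: (fmorph_inj (@real_complex R)); rewrite rmorph_sum rmorph1 -[RHS]E.
apply: eq_bigr => k _.
by rewrite !mxE rmorphXn /= normc_norm normCK.
Qed.

(** The rows of a unitary matrix are unit vectors, so Cauchy--Schwarz applies to each
    entry of the slice. *)
Lemma slice_le_tfrobenius Phi A w : Phi \is unitarymx ->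
  fro (slice Phi A w) <= tfrobenius A.
Proof.
move=> U; apply: le_sqr; first exact: sqrtr_ge0.
rewrite [leRHS]sqr_sqrtr; last by apply: sumr_ge0 => k _; rewrite sqr_ge0.
rewrite sqr_frobenius_pair.
under [leRHS]eq_bigr do rewrite sqr_frobenius_pair.
rewrite exchange_big /=; apply: ler_sum => -[i j] _ /=.
rewrite /slice summxE -[leRHS]mul1r -(sum_row_unitary w U).
under [X in normc X]eq_bigr do rewrite mxE.
exact: normc_dot_le.
Qed.

Definition GT_constant (a b : R) := 2 * expR (32 * (1 + a + b)).

Lemma defect_bounds Phi A B : Phi \is unitarymx ->
  thermitian Phi A -> thermitian Phi B ->
  - (GT_constant (tfrobenius A) (tfrobenius B) * noncomm Phi A B)%:C <= defect Phi A B
    <= (GT_constant (tfrobenius A) (tfrobenius B) * noncomm Phi A B)%:C.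
Proof.
move=> U /thermitianP hA /thermitianP hB; set C := GT_constant _ _.
have a0 : 0 <= tfrobenius A by exact: sqrtr_ge0.
have b0 : 0 <= tfrobenius B by exact: sqrtr_ge0.
have H w : - (C * fro (commx (slice Phi A w) (slice Phi B w)) ^+ 2)%:C
    <= GT_gap (slice Phi A w) (slice Phi B w)
    <= (C * fro (commx (slice Phi A w) (slice Phi B w)) ^+ 2)%:C.
  apply: (GT_gap_herm_le (hA w) (hB w)); first by rewrite -addrA lerDl addr_ge0.
    by apply: le_trans (slice_le_tfrobenius _ _ U) _; rewrite addrAC lerDr addr_ge0.
  by apply: le_trans (slice_le_tfrobenius _ _ U) _; rewrite lerDr addr_ge0.
rewrite defectE // /noncomm mulr_sumr rmorph_sum /= -sumrN.
by apply/andP; split; apply: ler_sum => w _; have /andP[] := H w.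
Qed.

Lemma defect_small_bounds Phi A B : Phi \is unitarymx ->
  thermitian Phi A -> thermitian Phi B ->
  (forall w, fro (slice Phi A w) <= small_radius) ->
  (forall w, fro (slice Phi B w) <= small_radius) ->
  (1 / 48 * noncomm Phi A B)%:C <= defect Phi A B <= (1 / 12 * noncomm Phi A B)%:C.
Proof.
move=> U /thermitianP hA /thermitianP hB sA sB.
rewrite defectE // /noncomm !mulr_sumr !rmorph_sum /=.
by apply/andP; split; apply: ler_sum => w _;
  have := GT_gap_small (hA w) (hB w) (sA w) (sB w);
  rewrite !(mulrC _ (_ ^+ 2)) !mulrA !mulr1 => /andP[].
Qed.

(** [defect_bounds] encloses the defect between two multiples of 0. *)
Lemma defect_commuting Phi A B : Phi \is unitarymx ->
  thermitian Phi A -> thermitian Phi B ->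
  (forall w, commx (slice Phi A w) (slice Phi B w) = 0) -> defect Phi A B = 0.
Proof.
move=> U hA hB comm0.
have nc0 : noncomm Phi A B = 0.
  by apply: big1 => w _; rewrite comm0 frobenius0 expr0n.
apply/eqP; rewrite eq_le andbC; have := defect_bounds U hA hB.
by rewrite nc0 /= mulr0 oppr0.
Qed.

End TensorDefect.

(** * Pauli matrices *)

Section ComplexCosh.
Context {R : realType}.

(** [e] is the exponential of [z]; a relation suffices, as the sum of the series is
    computed for real and for purely imaginary [z] only. *)
Definition is_cexp (z e : R[i]) :=
  (fun n => normc (series (fun k => (k`!%:R)^-1 * z ^+ k) n - e)) @ \oo --> (0 : R).

(** [c] is the value at [z] of the entire function cosh. *)
Definition is_ccosh (z c : R[i]) :=
  exists e e', [/\ is_cexp z e, is_cexp (- z) e' & c = (e + e') / 2].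

Lemma is_cexp_real (x : R) : is_cexp x%:C (expR x)%:C.
Proof.
rewrite /is_cexp.
rewrite [X in X @ _ --> _](_ : _ = fun n => `|series (exp_coeff x) n - expR x|).
  apply/norm_cvg0P/subr_cvg0; exact: is_cvg_series_exp_coeff.
apply/funext => n; rewrite -normc_real rmorphB rmorph_sum; congr (normc (_ - _)).
apply: eq_bigr => k _.
by rewrite /exp_coeff /= rmorphM fmorphV rmorph_nat rmorphXn mulrC.
Qed.

Lemma is_ccosh_real (x : R) : is_ccosh x%:C ((expR x + expR (- x)) / 2)%:C.
Proof.
exists (expR x)%:C, (expR (- x))%:C; split; first exact: is_cexp_real.
  by rewrite -rmorphN; exact: is_cexp_real.
by rewrite rmorphM rmorphD fmorphV rmorph_nat.
Qed.

Lemma is_cexp_imag (t : R) : is_cexp (t%:C * 'i) (cos t +i* sin t).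
Proof.
have Ek k : (k`!%:R)^-1 * (t%:C * 'i) ^+ k = cos_coeff t k +i* sin_coeff t k.
  have -> : (k`!%:R)^-1 * (t%:C * 'i) ^+ k = (t ^+ k / k`!%:R)%:C * 'i ^+ k.
    by rewrite exprMn rmorphM fmorphV rmorph_nat rmorphXn mulrCA mulrA.
  have -> : 'i ^+ k = (-1) ^+ k./2 * 'i ^+ odd k :> R[i].
    by rewrite -{1}(odd_double_half k) exprD -mul2n exprM sqr_i mulrC.
  rewrite -(rmorphN1 (@real_complex R)) -rmorphXn /cos_coeff /sin_coeff /=.
  case: (odd k) (odd_double_half k) => /= Ek.
    rewrite expr1; apply/eqP; rewrite eq_complex /=.
    apply/andP; split; apply/eqP; first by ring.
    have -> : k.-1./2 = k./2 by rewrite -{1}Ek add1n /= doubleK.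
    ring.
  rewrite expr0 mulr1 -rmorphM; apply/eqP; rewrite eq_complex /=.
  by apply/andP; split; apply/eqP; rewrite -?exprnP; ring.
rewrite /is_cexp.
have cvg0 (f : nat -> R) : cvgn f -> (fun n => `|f n - limn f|) @ \oo --> (0 : R).
  by move=> cf; apply/norm_cvg0P/subr_cvg0.
have := null_add (cvg0 _ (@is_cvg_series_cos_coeff R t))
  (cvg0 _ (@is_cvg_series_sin_coeff R t)).
apply: (squeeze_cvgr _ (@cvg_cst _ _ _ _ _)); apply: nearW => n.
rewrite normc_ge0 /=; apply: le_trans (normc_le_ReIm _) _.
rewrite !raddfB /= /series /= !raddf_sum /=.
under eq_bigr do rewrite Ek /=. under [X in _ + `|X - _|]eq_bigr do rewrite Ek /=.
by rewrite cos.unlock sin.unlock.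
Qed.

Lemma is_ccosh_imag (t : R) : is_ccosh (t%:C * 'i) (cos t)%:C.
Proof.
exists (cos t +i* sin t), (cos (- t) +i* sin (- t)); split; first exact: is_cexp_imag.
  by rewrite -mulNr -rmorphN; exact: is_cexp_imag.
have -> : (cos t +i* sin t) + (cos (- t) +i* sin (- t)) = (cos t)%:C * 2.
  rewrite cosN sinN mulr_natr mulr2n; apply/eqP; rewrite eq_complex /=.
  by rewrite subrr addr0 !eqxx.
by rewrite mulfK ?pnatr_eq0.
Qed.

End ComplexCosh.

Section Pauli.
Context {R : realType} {n : nat}.
Implicit Types N P X Z : 'M[R[i]]_n.

Lemma mx_cvgZ (u : nat -> R[i]) (l : R[i]) X :
  (fun k => normc (u k - l)) @ \oo --> (0 : R) -> mx_cvg (fun k => u k *: X) (l *: X).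
Proof.
move=> ul; apply: mx_cvg_le (null_mulr (fro X) ul) => k.
by rewrite -scalerBl frobeniusZ mulrC.
Qed.

(** On the range of the projection [P], [N] is an involution with eigenprojections
    [(P + N) / 2] and [(P - N) / 2], so that the exponential of [z *: N] acts as [e], [e']
    and 1 on three complementary subspaces. The coefficient of [N] is left implicit, as
    traces only see that of [P]. *)
Lemma expmx_involution N P (z c : R[i]) : N * N = P -> P * N = N -> N * P = N ->
  is_ccosh z c -> exists d, expmx (z *: N) = 1 - P + c *: P + d *: N.
Proof.
move=> NN PN NP [e [e' [ze ze' ->]]]; exists ((e - e') / 2).
pose Q1 := 2^-1 *: (P + N); pose Q2 := 2^-1 *: (P - N).
have PP : P * P = P by rewrite -{1}NN -mulrA NP NN.
have NQ1 : N * Q1 = Q1 by rewrite /Q1 -mxscaleAr mulrDr NN NP addrC.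
have NQ2 : N * Q2 = - Q2 by rewrite /Q2 -mxscaleAr mulrBr NN NP -scalerN opprB.
have Q12 : Q1 + Q2 = P.
  rewrite /Q1 /Q2 -scalerDr addrACA subrr addr0 -mulr2n -[P *+ 2]scaler_nat.
  by rewrite scalerA mulVf ?pnatr_eq0 // scale1r.
have -> : 1 - P + ((e + e') / 2) *: P + ((e - e') / 2) *: N =
    (1 : R[i]) *: (1 - P) + e *: Q1 + e' *: Q2.
  rewrite scale1r -!addrA; congr (_ + (_ + _)).
  rewrite /Q1 /Q2 !scalerA !scalerDr !scalerN addrACA -scalerDl -scalerBl.
  by rewrite -mulrDl -mulrBl.
move: {Q1 Q2} (Q1) (Q2) NQ1 NQ2 Q12 => Q1 Q2 NQ1 NQ2 Q12.
have powE k : (z *: N) ^+ k = 0 ^+ k *: (1 - P) + z ^+ k *: Q1 + (- z) ^+ k *: Q2.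
  elim: k => [|k IH]; first by rewrite !expr0 !scale1r -addrA Q12 subrK.
  rewrite exprS IH !mulrDr -!mxscaleAr -!mxscaleAl mulrBr mulr1 NP subrr !scaler0 add0r.
  rewrite NQ1 NQ2 scalerN -scaleNr expr0n scale0r add0r !scalerA !exprS.
  by rewrite [z * z ^+ k]mulrC [- z * _]mulrC.
apply: mx_cvg_unique (expS_cvg _) _.
have z0 : is_cexp (0 : R[i]) 1 by have := @is_cexp_real R 0; rewrite expR0.
have := mx_cvgD (mx_cvgD (mx_cvgZ (1 - P) z0) (mx_cvgZ Q1 ze)) (mx_cvgZ Q2 ze').
congr mx_cvg; apply/funext => k; rewrite /expS /series /= !scaler_suml -!big_split /=.
by apply: eq_bigr => l _; rewrite powE !scalerDr !scalerA.
Qed.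

Variables X Z P : 'M[R[i]]_n.
Hypotheses (XX : X * X = P) (ZZ : Z * Z = P) (XZ : X * Z = - (Z * X)).
Hypotheses (PX : P * X = X) (XP : X * P = X) (PZ : P * Z = Z) (ZP : Z * P = Z).
Hypotheses (trX : \tr X = 0) (trZ : \tr Z = 0).

(** Since [X] and [Z] anticommute, [a *: X + b *: Z] is again an involution on the
    range of [P], and [expmx_involution] applies to all three exponentials. *)
Lemma GT_gap_pauli (z a b c1 c2 c3 : R[i]) : a ^+ 2 + b ^+ 2 = 1 ->
  is_ccosh (z * a) c1 -> is_ccosh (z * b) c2 -> is_ccosh z c3 ->
  GT_gap ((z * a) *: X) ((z * b) *: Z) = \tr P * (c1 * c2 - c3).
Proof.
move=> ab1 h1 h2 h3.
have PP : P * P = P by rewrite -{1}XX -mulrA XP XX.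
pose N := a *: X + b *: Z.
have NN : N * N = P.
  rewrite /N mulrDl !mulrDr -!mxscaleAl -!mxscaleAr XX ZZ XZ !scalerA !scalerN.
  rewrite [b * a]mulrC addrA subrK -scalerDl -!expr2 ab1 scale1r //.
have PN : P * N = N by rewrite /N mulrDr -!mxscaleAr PX PZ.
have NP : N * P = N by rewrite /N mulrDl -!mxscaleAl XP ZP.
have [d1 E1] := expmx_involution XX PX XP h1.
have [d2 E2] := expmx_involution ZZ PZ ZP h2.
have [d3 E3] := expmx_involution NN PN NP h3.
have QP : (1 - P) * P = 0 by rewrite mulrBl mul1r PP subrr.
have PQ : P * (1 - P) = 0 by rewrite mulrBr mulr1 PP subrr.
have QZ : (1 - P) * Z = 0 by rewrite mulrBl mul1r PZ subrr.
have XQ : X * (1 - P) = 0 by rewrite mulrBr mulr1 XP subrr.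
have QQ : (1 - P) * (1 - P) = 1 - P by rewrite mulrBr mulr1 QP subr0.
have trXZ : \tr (X * Z) = 0.
  have : \tr (X * Z) *+ 2 = 0.
    by rewrite mulr2n {2}XZ linearN /= [\tr (Z * X)]mxtrace_mulrC subrr.
  by move/eqP; rewrite mulrn_eq0 /= => /eqP.
rewrite /GT_gap.
have -> : (z * a) *: X + (z * b) *: Z = z *: N by rewrite /N scalerDr !scalerA.
have -> : expmx ((z * a) *: X) *m expmx ((z * b) *: Z) =
    1 - P + (c1 * c2) *: P + (c1 * d2) *: Z + (d1 * c2) *: X + (d1 * d2) *: (X * Z).
  rewrite E1 E2 mulmxE; move: {E1 E2 E3} (1 - P) QP PQ QZ XQ QQ => Q QP PQ QZ XQ QQ.
  rewrite !mulrDl !mulrDr -!mxscaleAl -!mxscaleAr QQ QP QZ PQ XQ PP PZ XP.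
  by rewrite !scaler0 !addr0 !add0r !scalerA !addrA.
rewrite E3 !mxtraceD !mxtraceZ trX trZ trXZ /N mxtraceD !mxtraceZ trX trZ; ring.
Qed.

End Pauli.

Section Matrices.
Context {R : realType} {n : nat} (n1 : (1 < n)%N).

Let i0 : 'I_n := Ordinal (ltnW n1).
Let i1 : 'I_n := Ordinal n1.

Definition pauliX : 'M[R[i]]_n := delta_mx i0 i1 + delta_mx i1 i0.
Definition pauliZ : 'M[R[i]]_n := delta_mx i0 i0 - delta_mx i1 i1.
Definition pauli1 : 'M[R[i]]_n := delta_mx i0 i0 + delta_mx i1 i1.

Let i01 : (i0 == i1) = false. Proof. by []. Qed.
Let i10 : (i1 == i0) = false. Proof. by []. Qed.

Let deltaM (a b c d : 'I_n) : (delta_mx a b : 'M[R[i]]_n) * delta_mx c d =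
  if b == c then delta_mx a d else 0.
Proof.
have [->|bc] := eqVneq b c; first by rewrite -mulmxE mul_delta_mx.
by rewrite -mulmxE mul_delta_mx_0.
Qed.

Ltac pauli_mul := rewrite /pauliX /pauliZ /pauli1
  ?(mulrDl, mulrDr, mulrBl, mulrBr, mulNr, mulrN) !deltaM ?(eqxx, i01, i10)
  ?(subr0, addr0, add0r, sub0r, oppr0, opprK, opprB, opprD).

Lemma pauliXX : pauliX * pauliX = pauli1.
Proof. by pauli_mul. Qed.
Lemma pauliZZ : pauliZ * pauliZ = pauli1.
Proof. by pauli_mul. Qed.
Lemma pauliXZ : pauliX * pauliZ = - (pauliZ * pauliX).
Proof. by pauli_mul; rewrite addrC. Qed.
Lemma pauli1X : pauli1 * pauliX = pauliX.
Proof. by pauli_mul. Qed.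
Lemma pauliX1 : pauliX * pauli1 = pauliX.
Proof. by pauli_mul; rewrite addrC. Qed.
Lemma pauli1Z : pauli1 * pauliZ = pauliZ.
Proof. by pauli_mul. Qed.
Lemma pauliZ1 : pauliZ * pauli1 = pauliZ.
Proof. by pauli_mul. Qed.

Let tr_delta (a b : 'I_n) : \tr (delta_mx a b : 'M[R[i]]_n) = (a == b)%:R.
Proof.
rewrite /mxtrace (bigD1 a) //= big1 ?addr0 => [|c ca]; rewrite !mxE ?eqxx //.
by rewrite (negPf ca).
Qed.

Lemma tr_pauliX : \tr pauliX = 0.
Proof. by rewrite mxtraceD !tr_delta i01 i10 addr0. Qed.
Lemma tr_pauliZ : \tr pauliZ = 0.
Proof. by rewrite raddfB /= !tr_delta !eqxx subrr. Qed.
Lemma tr_pauli1 : \tr pauli1 = 2.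
Proof. by rewrite mxtraceD !tr_delta !eqxx -natrD. Qed.

Lemma adj_delta (a b : 'I_n) : (delta_mx a b : 'M[R[i]]_n)^t* = delta_mx b a.
Proof. by rewrite trmx_delta map_delta_mx. Qed.

Lemma pauliX_adj : pauliX^t* = pauliX.
Proof. by rewrite adjmxD !adj_delta addrC. Qed.
Lemma pauliZ_adj : pauliZ^t* = pauliZ.
Proof. by rewrite linearB map_mxB !adj_delta. Qed.

Lemma GT_gap_pauliXZ (u v z c1 c2 c3 : R[i]) : z != 0 -> u ^+ 2 + v ^+ 2 = z ^+ 2 ->
  is_ccosh u c1 -> is_ccosh v c2 -> is_ccosh z c3 ->
  GT_gap (u *: pauliX) (v *: pauliZ) = 2 * (c1 * c2 - c3).
Proof.
move=> z0 uvz.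
have -> : u = z * (u / z) by rewrite mulrC divfK.
have -> : v = z * (v / z) by rewrite mulrC divfK.
have : (u / z) ^+ 2 + (v / z) ^+ 2 = 1.
  by rewrite !expr_div_n -mulrDl uvz divff // expf_neq0.
rewrite -tr_pauli1; apply: GT_gap_pauli.
- exact: pauliXX.
- exact: pauliZZ.
- exact: pauliXZ.
- exact: pauli1X.
- exact: pauliX1.
- exact: pauli1Z.
- exact: pauliZ1.
- exact: tr_pauliX.
- exact: tr_pauliZ.
Qed.

End Matrices.

(** * Transform sensitivity *)

Section Sensitivity.
Context {R : realType} {n : nat} (n1 : (1 < n)%N).
Local Notation X := (@pauliX R n n1).
Local Notation Z := (@pauliZ R n n1).

(** The gap of [3 * s] times [X] and [4 * s] times [Z]. The triple (3, 4, 5) makes the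
    norm of the sum an integral multiple of [s]. *)
Definition cosh_gap (s : R) : R :=
  let ch x := (expR x + expR (- x)) / 2 in 2 * (ch (3 * s) * ch (4 * s) - ch (5 * s)).

(** In terms of [x = expR s] the gap is [(x ^+ 7 + x) / 2 - x ^+ 5], up to negative
    powers of [x]. *)
Lemma cosh_gap_ge (s q : R) : 0 <= q -> 2 * q <= s -> 2 <= s -> q <= cosh_gap s.
Proof.
move=> q0 qs s2; rewrite /cosh_gap !expRN !(expRM_natl 3) !(expRM_natl 4) !(expRM_natl 5).
have : 1 + s <= expR s by exact: expR_ge1Dx.
move: (expR s) => x sx; have x3 : 3 <= x by lra.
have x0 : x != 0 by rewrite gt_eqF; lra.
have -> : 2 * ((x ^+ 3 + (x ^+ 3)^-1) / 2 * ((x ^+ 4 + (x ^+ 4)^-1) / 2) -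
    (x ^+ 5 + (x ^+ 5)^-1) / 2) =
  (x ^+ 7 + x^-1 ^+ 7 + x + x^-1) / 2 - (x ^+ 5 + x^-1 ^+ 5) by field.
have y0 : 0 <= x^-1 by rewrite invr_ge0; lra.
have y1 : x^-1 <= 1 by rewrite invf_le1; lra.
have y5 : x^-1 ^+ 5 <= 1 by rewrite exprn_ile1.
have y7 : 0 <= x^-1 ^+ 7 by rewrite exprn_ge0.
have x5 : x <= x ^+ 5 by rewrite ler_eXnr //; lra.
have x7 : 9 * x ^+ 5 <= x ^+ 7.
  rewrite (_ : 7%N = 2 + 5)%N // exprD ler_wpM2r //; first by lra.
  by rewrite expr2; nra.
lra.
Qed.

Lemma GT_gap_real (a b z : R) : z != 0 -> a ^+ 2 + b ^+ 2 = z ^+ 2 ->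
  GT_gap (a%:C *: X) (b%:C *: Z) =
  (2 * ((expR a + expR (- a)) / 2 * ((expR b + expR (- b)) / 2)
     - (expR z + expR (- z)) / 2))%:C.
Proof.
move=> z0 abz.
rewrite (@GT_gap_pauliXZ _ _ _ _ _ z%:C _ _ _ _ _
  (is_ccosh_real a) (is_ccosh_real b) (is_ccosh_real z)).
- by rewrite !(rmorphM, rmorphB, rmorphD, fmorphV, rmorph_nat).
- by rewrite fmorph_eq0.
by rewrite -!rmorphXn -rmorphD abz.
Qed.

Lemma GT_gap_imag (a b z : R) : z != 0 -> a ^+ 2 + b ^+ 2 = z ^+ 2 ->
  GT_gap ((a%:C * 'i) *: X) ((b%:C * 'i) *: Z) = (2 * (cos a * cos b - cos z))%:C.
Proof.
move=> z0 abz.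
rewrite (@GT_gap_pauliXZ _ _ _ _ _ (z%:C * 'i) _ _ _ _ _
  (is_ccosh_imag a) (is_ccosh_imag b) (is_ccosh_imag z)).
- by rewrite !(rmorphM, rmorphB, rmorph_nat).
- by rewrite mulf_neq0 ?fmorph_eq0 // eq_complex /= oner_eq0 andbF.
by rewrite !exprMn -mulrDl -!rmorphXn -rmorphD abz.
Qed.

Lemma cos_npi k : cos (k%:R * pi) = (-1) ^+ k :> R.
Proof.
elim: k => [|k IH]; first by rewrite mul0r cos0.
by rewrite -natr1 mulrDl mul1r cosDpi IH exprS mulN1r.
Qed.

Lemma GT_gap00 : GT_gap (0 : 'M[R[i]]_n) 0 = 0.
Proof.
apply: eq0_normc; apply/eqP.
rewrite eq_le normc_ge0 andbT.
apply: le_trans (GT_gap_le (M := 1) _ _ _) _; rewrite ?frobenius0 //.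
by rewrite /commx mul0mx subrr frobenius0 expr0n mulr0.
Qed.

Variable p : nat.

Definition line_tensor (x : nat -> R) (M : 'M[R[i]]_n) : tensor R n p :=
  [ffun k : 'I_p => (x k)%:C *: M].

Lemma slice_line (h : 'M[R]_p) x M w :
  slice (map_mx (@real_complex R) h) (line_tensor x M) w =
  (\sum_k h w k * x k)%:C *: M.
Proof.
rewrite /slice rmorph_sum scaler_suml; apply: eq_bigr => k _ /=.
by rewrite ffunE mxE scalerA rmorphM.
Qed.

Lemma slice_scalar (a : R[i]) A w :
  slice (a%:M : 'M[R[i]]_p) A w = a *: A w :> 'M[R[i]]_n.
Proof.
rewrite /slice (bigD1 w) //= big1 ?addr0 => [|k kw]; rewrite mxE ?eqxx ?mulr1n //.
by rewrite eq_sym (negPf kw) mulr0n scale0r.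
Qed.

Lemma adjmxZ_real (a : R) (M : 'M[R[i]]_n) : M^t* = M -> (a%:C *: M)^t* = a%:C *: M.
Proof.
move=> hM; rewrite linearZ map_mxZ hM; congr (_ *: _).
by apply/eqP; rewrite eq_complex /= oppr0 !eqxx.
Qed.

Lemma scalar_unitary (a : R[i]) : `|a| = 1 -> (a%:M : 'M[R[i]]_p) \is unitarymx.
Proof.
move=> a1; apply/unitarymxP.
by rewrite tr_scalar_mx map_scalar_mx -scalar_mxM -normCK a1 expr1n.
Qed.

Lemma sum_pair (f : nat -> R) x y (p1 : (1 < p)%N) :
  \sum_(k < p) f k * nth 0 [:: x; y] k = f 0%N * x + f 1%N * y.
Proof.
rewrite -(big_mkord xpredT (fun k => f k * nth 0 [:: x; y] k)).
rewrite big_ltn ?(ltnW p1) // big_ltn //= big_nat big1 ?addr0 // => k /andP[k2 _].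
by rewrite nth_default ?mulr0.
Qed.

(** The reflection of R^p in the direction [u = (1, -2, 0, ...)]; it is chosen
    so that it maps (3, 4, 0, ...) and (4, -3, 0, ...) to multiples of two
    different basis vectors. *)
Definition reflection : 'M[R]_p :=
  \matrix_(w, k) ((w == k)%:R - 2 / 5 * nth 0 [:: 1; -2] w * nth 0 [:: 1; -2] k).

Lemma reflection_sum x y (w : 'I_p) : (1 < p)%N ->
  \sum_k reflection w k * nth 0 [:: x; y] k =
  ((w == 0%N :> nat)%:R - 2 / 5 * nth 0 [:: 1; -2] w) * x
  + ((w == 1%N :> nat)%:R + 4 / 5 * nth 0 [:: 1; -2] w) * y.
Proof.
move=> p1; under eq_bigr do rewrite mxE.
rewrite (sum_pair (fun k => (w == k :> nat)%:R -
  2 / 5 * nth 0 [:: 1; -2] w * nth 0 [:: 1; -2] k)) //=.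
by congr (_ * _ + _ * _); field.
Qed.

Lemma reflection_unitary (p1 : (1 < p)%N) :
  map_mx (@real_complex R) reflection \is unitarymx.
Proof.
pose u : 'rV[R]_p := \row_k nth 0 [:: 1; -2] k.
have HE : reflection = 1%:M - (2 / 5) *: (u^T *m u).
  by apply/matrixP => v w; rewrite !mxE big_ord1 !mxE mulrA.
have uu : u *m u^T = 5%:M.
  apply/matrixP => v w; rewrite !ord1 !mxE eqxx.
  under eq_bigr do rewrite !mxE.
  by rewrite (sum_pair (fun k => nth 0 [:: 1; -2] k)) //=; ring.
have HT : reflection^T = reflection.
  by apply/matrixP => v w; rewrite !mxE eq_sym mulrAC.
apply/unitarymxP.
have -> : (map_mx (@real_complex R) reflection)^t* = map_mx (@real_complex R) reflection.
  rewrite -[in RHS]HT; apply/matrixP => v w; rewrite !mxE.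
  by apply/eqP; rewrite eq_complex /= oppr0 !eqxx.
rewrite -map_mxM -(map_mx1 (@real_complex R)); congr map_mx.
have : (u^T *m u) *m (u^T *m u) = 5 *: (u^T *m u).
  by rewrite mulmxA -[u^T *m u *m u^T]mulmxA uu mul_mx_scalar -scalemxAl.
rewrite HE; move: (u^T *m u) => V VV.
rewrite mulmxBl mul1mx mulmxBr mulmx1 -scalemxAl -scalemxAr VV !scalerA.
have -> : 2 / 5 * (2 / 5) * 5 = 2 / 5 + 2 / 5 :> R by field.
by rewrite scalerDl opprB addrK subrK.
Qed.

(** The slices of [A] are proportional to [X], those of [B] to [Z], and for the identity
    transform two pairs of slices have gap [cosh_gap s], which grows with [s]. For [p > 1]
    the reflection sends the coefficients of [A] and [B] to different basis vectors, so
    that each slice of one meets a zero slice of the other. For [p = 1] the scalar ['i]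
    turns cosh into cos, and [cos (3 * pi) * cos (4 * pi) = cos (5 * pi)]. *)
Lemma sensitivity : (0 < p)%N ->
  exists (A B : tensor R n p) (Phi1 Phi2 : 'M[R[i]]_p),
    [/\ Phi1 \is unitarymx, Phi2 \is unitarymx,
        thermitian Phi2 A /\ thermitian Phi2 B,
        (1 < p)%N -> thermitian Phi1 A /\ thermitian Phi1 B
      & defect Phi1 A B = 0 /\ (1 * p%:R)%:C <= defect Phi2 A B].
Proof.
(* a multiple of pi for the case of one slice, and large enough for the bound [p] *)
move=> p0; pose s : R := p%:R * pi.
have pi2 : 2 <= pi :> R by exact: pi_ge2.
have p1 : 1 <= p%:R :> R by rewrite ler1n.
have s2p : 2 * p%:R <= s by rewrite /s mulrC ler_wpM2l.
have s2 : 2 <= s by lra.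
pose A := line_tensor (fun k => nth 0 [:: 3 * s; 4 * s] k) X.
pose B := line_tensor (fun k => nth 0 [:: 4 * s; - (3 * s)] k) Z.
have AE (k : 'I_p) : A k = (nth 0 [:: 3 * s; 4 * s] k)%:C *: X by rewrite ffunE.
have BE (k : 'I_p) : B k = (nth 0 [:: 4 * s; - (3 * s)] k)%:C *: Z by rewrite ffunE.
have U1 : (1%:M : 'M[R[i]]_p) \is unitarymx by apply: scalar_unitary; rewrite normr1.
have herm1 (T : tensor R n p) : (forall k, (T k)^t* = T k) -> thermitian 1%:M T.
  by move=> hT; apply/thermitianP => w; rewrite slice_scalar scale1r.
have hA k : (A k)^t* = A k by rewrite AE adjmxZ_real // pauliX_adj.
have hB k : (B k)^t* = B k by rewrite BE adjmxZ_real // pauliZ_adj.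
have s5 : 5 * s != 0 by rewrite mulf_neq0 // gt_eqF //; lra.
have low : (1 * p%:R)%:C <= defect 1%:M A B.
  have gap_ge0 : 0 <= cosh_gap s by apply: cosh_gap_ge => //; lra.
  rewrite (defectE A B U1) (bigD1 (Ordinal p0)) //= mul1r.
  rewrite !slice_scalar !scale1r AE BE /= (GT_gap_real s5) -/(cosh_gap s); last by ring.
  rewrite -[leLHS]addr0; apply: lerD; first by rewrite lecR; apply: cosh_gap_ge.
  apply: sumr_ge0 => w w0; rewrite !slice_scalar !scale1r AE BE.
  case: w w0 => [[|[|k]] kp] //= _.
    rewrite (GT_gap_real s5) ?opprK; last by ring.
    rewrite (_ : 2 * _ = cosh_gap s) ?lecR //; rewrite /cosh_gap; ring.
  by rewrite !nth_nil !scale0r GT_gap00.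
have [p_le1|p_gt1] := leqP p 1.
  have Ui : ('i%:M : 'M[R[i]]_p) \is unitarymx.
    by apply: scalar_unitary; rewrite normc_def /= expr0n add0r expr1n sqrtr1.
  exists A, B, 'i%:M, 1%:M; split; [exact: Ui | exact: U1 | | | split; [|exact: low]].
  - by split; exact: herm1.
  - by [].
  rewrite (defectE A B Ui).
  apply: big1 => w _; rewrite !slice_scalar AE BE.
  have -> : val w = 0%N.
    by case: w => w /= wp; apply/eqP; rewrite -leqn0 -ltnS (leq_trans wp).
  rewrite /= !scalerA !(mulrC 'i) (GT_gap_imag s5); last by ring.
  rewrite /s !mulrA -!natrM !cos_npi -exprD -mulnDl.
  by rewrite -[in X in X - _]signr_odd -[in X in _ - X]signr_odd !oddM /= subrr mulr0.
exists A, B, (map_mx (@real_complex R) reflection), 1%:M.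
have UH := reflection_unitary p_gt1.
have sA w : slice (map_mx (@real_complex R) reflection) A w =
    (nth 0 [:: 5 * s; 0] w)%:C *: X.
  rewrite slice_line reflection_sum //; congr (_%:C *: _).
  by case: w => [[|[|k]] kp] /=; rewrite ?nth_nil; field.
have sB w : slice (map_mx (@real_complex R) reflection) B w =
    (nth 0 [:: 0; 5 * s] w)%:C *: Z.
  rewrite slice_line reflection_sum //; congr (_%:C *: _).
  by case: w => [[|[|k]] kp] /=; rewrite ?nth_nil; field.
have hHA : thermitian (map_mx (@real_complex R) reflection) A.
  by apply/thermitianP => w; rewrite sA adjmxZ_real // pauliX_adj.
have hHB : thermitian (map_mx (@real_complex R) reflection) B.
  by apply/thermitianP => w; rewrite sB adjmxZ_real // pauliZ_adj.
split; [exact: UH | exact: U1 | by split; exact: herm1 | by [] | split; [|exact: low]].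
apply: (defect_commuting UH hHA hHB) => w; rewrite sA sB.
by case: w => [[|[|k]] kp] /=; rewrite ?nth_nil ?scale0r /commx ?mul0mx ?mulmx0 subrr.
Qed.

End Sensitivity.

(** * Classes of positive measure *)

Section Box.
Context {R : realType}.
Local Notation RT := (measurableTypeR R).

Definition box (e : R) d : set (d.-tuple RT) :=
  [set t | forall q : 'I_d, `|tnth t q : R| < e].

Lemma measurable_box (e : R) d : measurable (@box e d).
Proof.
have -> : @box e d = \bigcap_(q in [set: 'I_d])
    ((fun t => tnth t q) @^-1` [set x : RT | `|x : R| < e]).
  by apply/seteqP; split => t H q; [move=> _|]; exact: H.
apply: fin_bigcap_measurable => [|q _]; first exact: finite_finset.
rewrite -[X in measurable X]setTI; apply: measurable_tnth => //.
have -> : [set x : RT | `|x : R| < e] = `]- e, e[%classic.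
  by apply/seteqP; split => x /=; rewrite in_itv /= ltr_norml.
exact: measurable_itv.
Qed.

Lemma lebesgue_vol0 d : lebesgue_vol (set0 : set (d.-tuple RT)) = 0%E.
Proof.
elim: d => [|d IH] /=; first exact: dirac0.
under eq_integral => x _ do rewrite (_ : [set t | _] = set0) ?IH //.
exact: integral0.
Qed.

(** A section of a box at [x] is a box of the same width or empty, according to
    whether [`|x| < e]. *)
Lemma lebesgue_vol_box (e : R) d : 0 < e -> lebesgue_vol (@box e d) = ((2 * e) ^+ d)%:E.
Proof.
move=> e0; elim: d => [|d IH].
  by rewrite /= diracE mem_set // => -[].
rewrite /=.
rewrite (_ : (fun x => _) = (cst ((2 * e) ^+ d)%:E) \_ (`]- e, e[%classic : set RT)).
  rewrite -integral_mkcond integral_cst; last exact: measurable_itv.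
  have mu_itv : lebesgue_measure (`]- e, e[%classic : set R) = (2 * e)%:E.
    by rewrite lebesgue_measure_itv /= lte_fin gtrN // -EFinB opprK mulr_natl mulr2n.
  by rewrite [X in (_ * X)%E]mu_itv -EFinM exprSr.
apply/funext => x; rewrite patchE; case: ifPn => xe.
  move: xe; rewrite inE /= in_itv /= -ltr_norml => xe.
  rewrite -IH; congr lebesgue_vol; apply/seteqP; split => t /= H q.
    by have := H (lift ord0 q); rewrite tnthS.
  by case: (unliftP ord0 q) => [j ->|->]; rewrite ?tnthS ?tnth0.
rewrite (_ : [set t | _] = set0) ?lebesgue_vol0 //.
apply/seteqP; split => t //= /(_ ord0); rewrite tnth0 => H; move: xe.
by rewrite notin_setE /= in_itv /= -ltr_norml H.
Qed.

End Box.

Section SmallClass.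
Context {R : realType} {n p : nat}.
Implicit Types (Phi : 'M[R[i]]_p).

(** Bounding the real and imaginary parts of the entries, rather than a norm, makes this
    class a box in the real coordinates of the slices. *)
Definition small_pairs Phi (e : R) : set (tensor R n p * tensor R n p) :=
  [set T | (thermitian Phi T.1 /\ thermitian Phi T.2) /\
    forall (b : bool) w i j, let z := slice Phi (if b then T.2 else T.1) w i j in
      `|complex.Re z| < e /\ `|complex.Im z| < e].

Lemma herm_of_adj (x : 'I_n -> 'I_n -> R) : (herm_of x)^t* = herm_of x.
Proof.
apply/matrixP => i j; rewrite !mxE; case: (ltngtP i j) => // ij.
- by apply/eqP; rewrite eq_complex /= opprK !eqxx.
- have -> : i = j by exact: val_inj.
  by apply/eqP; rewrite eq_complex /= oppr0 !eqxx.
Qed.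

Lemma preimage_small_pairs Phi (e : R) : 0 < e -> Phi \is unitarymx ->
  @herm_pair R n p Phi @^-1` small_pairs Phi e = box e (d := _).
Proof.
move=> e0 U; apply/seteqP; split => t.
  case=> _ /= H q; rewrite -(enum_valK q).
  case: (enum_val q) => [[[b w] i] j].
  have := H b w; rewrite (_ : (if b then _ else _) = tunlift Phi (\mxdiag_(w < p)
    herm_of (fun i j : 'I_n => tnth t (enum_rank ((b, w, i, j) : pair_index n p)))));
    last by case: b.
  rewrite slice_tunlift // submxblock_diag => {}H.
  case: (ltngtP i j) => ij.
  - by have [+ _] := H i j; rewrite mxE ij.
  - by have [_ +] := H j i; rewrite mxE ij.
  - by have [+ _] := H i j; rewrite mxE ij ltnn (_ : i = j) //; exact: val_inj.
move=> H; split.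
  by split; apply/thermitianP => w; rewrite slice_tunlift // submxblock_diag herm_of_adj.
move=> b w i j /=.
rewrite (_ : (if b then _ else _) = tunlift Phi (\mxdiag_(w < p)
    herm_of (fun i j : 'I_n => tnth t (enum_rank ((b, w, i, j) : pair_index n p)))));
    last by case: b.
rewrite slice_tunlift // submxblock_diag mxE.
by case: (ltngtP i j) => ij /=; rewrite ?normrN ?normr0.
Qed.

Lemma small_pairs_positive Phi (e : R) : 0 < e -> Phi \is unitarymx ->
  positive_measure_class Phi (small_pairs Phi e).
Proof.
move=> e0 U; split; first by move=> T [].
  by rewrite preimage_small_pairs //; exact: measurable_box.
by rewrite preimage_small_pairs // lebesgue_vol_box // lte_fin exprn_gt0 // mulr_gt0.
Qed.

Lemma frobenius_small_entries (M : 'M[R[i]]_n) (e : R) :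
  (forall i j, `|complex.Re (M i j)| < e /\ `|complex.Im (M i j)| < e) ->
  fro M <= (n * n)%:R * (2 * e).
Proof.
move=> H; apply: le_trans (frobenius_le_sum _) _.
apply: le_trans (_ : \sum_(ij : 'I_n * 'I_n) 2 * e <= _).
  apply: ler_sum => -[i j] _; apply: le_trans (normc_le_ReIm _) _ => /=.
  by have [h1 h2] := H i j; rewrite mulr_natl mulr2n lerD // ltW.
by rewrite sumr_const card_prod !card_ord -[leLHS]mulr_natl.
Qed.

(** There are [n * n] entries; the successor keeps the denominator positive. *)
Definition class_radius : R := small_radius / (2 * (n * n).+1%:R).

Lemma class_radius_gt0 : 0 < class_radius.
Proof. by rewrite divr_gt0 ?small_radius_gt0 // mulr_gt0 ?ltr0n. Qed.

Lemma small_pairs_bounds Phi A B : Phi \is unitarymx ->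
  small_pairs Phi class_radius (A, B) ->
  (1 / 48 * noncomm Phi A B)%:C <= defect Phi A B <= (1 / 12 * noncomm Phi A B)%:C.
Proof.
move=> U [[/= hA hB] H].
have small (M : 'M[R[i]]_n) : (forall i j, `|complex.Re (M i j)| < class_radius /\
    `|complex.Im (M i j)| < class_radius) -> fro M <= small_radius.
  move=> /frobenius_small_entries HM; apply: le_trans HM _.
  apply: (@le_trans _ _ ((n * n).+1%:R * (2 * class_radius))).
    by rewrite ler_wpM2r ?mulr_ge0 ?(ltW class_radius_gt0) // ler_nat.
  have N0 : (n * n).+1%:R != 0 :> R by rewrite pnatr_eq0.
  rewrite /class_radius; move: (_.+1%:R) N0 => N N0.
  by rewrite le_eqVlt; apply/orP; left; apply/eqP; field.
apply: defect_small_bounds => // w; apply: small => i j.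
  exact: (H false).
exact: (H true).
Qed.

End SmallClass.

(** * Smooth dependence on parameters *)

Section CkCalculus.
Context {R : realType} {V : normedModType R}.
Implicit Types f g : V -> R^o.

Lemma CkS k f : Ck k.+1 f -> Ck k f.
Proof.
elim: k f => [|k IH] f [cf H]; first by split.
by split=> // v; have [dv Dv] := H v; split=> //; exact: IH.
Qed.

Lemma Ck_cst k (c : R) : Ck k (fun _ : V => c : R^o).
Proof.
elim: k c => [|k IH] c; first by split=> //; exact: cst_continuous.
split; first exact: cst_continuous.
move=> v; split=> [x|]; first exact: derivable_cst.
rewrite (_ : 'D_v _ = fun _ => 0 : R^o) //.
by apply/funext => x; rewrite derive_cst.
Qed.

Lemma CkD k f g : Ck k f -> Ck k g -> Ck k (f + g).
Proof.
elim: k f g => [|k IH] f g [cf Hf] [cg Hg].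
  by split=> // x; apply: continuousD; [exact: cf|exact: cg].
split; first by move=> x; apply: continuousD; [exact: cf|exact: cg].
move=> v; have [df Df] := Hf v; have [dg Dg] := Hg v.
split=> [x|]; first by apply: derivableD.
rewrite (_ : 'D_v (f + g) = 'D_v f + 'D_v g); first exact: IH.
by apply/funext => x; rewrite deriveD.
Qed.

Lemma CkM k f g : Ck k f -> Ck k g -> Ck k (f * g : V -> R^o).
Proof.
elim: k f g => [|k IH] f g Cf Cg.
  by split=> // x; apply: continuousM; [exact: (proj1 Cf) | exact: (proj1 Cg)].
split=> [x|v].
  by apply: continuousM; [exact: (proj1 Cf) | exact: (proj1 Cg)].
have [_ /(_ v)[df Df]] := Cf; have [_ /(_ v)[dg Dg]] := Cg.
split=> [x|]; first by apply: derivableM.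
rewrite (_ : 'D_v (f * g) = f * 'D_v g + g * 'D_v f).
  by apply: CkD; apply: IH => //; exact: CkS.
by apply/funext => x; rewrite deriveM.
Qed.

Lemma CkN k f : Ck k f -> Ck k (- f).
Proof.
move=> Cf; rewrite (_ : - f = (fun _ : V => -1 : R^o) * f); last first.
  by apply/funext => x; exact: esym (mulN1r (f x : R)).
by apply: CkM => //; exact: Ck_cst.
Qed.

Definition cCk k (g : V -> R[i]) : Prop :=
  Ck k (fun x => complex.Re (g x) : R^o) /\ Ck k (fun x => complex.Im (g x) : R^o).

Lemma cCkD k (g h : V -> R[i]) : cCk k g -> cCk k h -> cCk k (fun x => g x + h x).
Proof.
move=> [gr gi] [hr hi]; split.
  by rewrite (_ : (fun x => _) =
      (fun x => complex.Re (g x) : R^o) + (fun x => complex.Re (h x) : R^o));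
    [exact: CkD | apply/funext => x; rewrite raddfD].
by rewrite (_ : (fun x => _) =
    (fun x => complex.Im (g x) : R^o) + (fun x => complex.Im (h x) : R^o));
  [exact: CkD | apply/funext => x; rewrite raddfD].
Qed.

Lemma cCkN k (g : V -> R[i]) : cCk k g -> cCk k (fun x => - g x).
Proof.
move=> [gr gi]; split.
  by rewrite (_ : (fun x => _) = - (fun x => complex.Re (g x) : R^o));
    [exact: CkN | apply/funext => x; rewrite raddfN].
by rewrite (_ : (fun x => _) = - (fun x => complex.Im (g x) : R^o));
  [exact: CkN | apply/funext => x; rewrite raddfN].
Qed.

Lemma cCkM k (g h : V -> R[i]) : cCk k g -> cCk k h -> cCk k (fun x => g x * h x).
Proof.
move=> [gr gi] [hr hi]; split.
  rewrite (_ : (fun x => _) =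
    ((fun x => complex.Re (g x) : R^o) * (fun x => complex.Re (h x) : R^o))
    + - ((fun x => complex.Im (g x) : R^o) * (fun x => complex.Im (h x) : R^o))).
    by apply: CkD; [exact: CkM | apply: CkN; exact: CkM].
  apply/funext => x; transitivity (complex.Re (g x) * complex.Re (h x)
    - complex.Im (g x) * complex.Im (h x)) => //.
  by case: (g x) (h x) => a b [c d].
rewrite (_ : (fun x => _) =
    ((fun x => complex.Re (g x) : R^o) * (fun x => complex.Im (h x) : R^o))
    + ((fun x => complex.Im (g x) : R^o) * (fun x => complex.Re (h x) : R^o))).
  by apply: CkD; exact: CkM.
apply/funext => x; transitivity (complex.Re (g x) * complex.Im (h x)
  + complex.Im (g x) * complex.Re (h x)) => //.
by case: (g x) (h x) => a b [c d].
Qed.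

Lemma cCk_sum k (I : Type) (r : seq I) (g : I -> V -> R[i]) :
  (forall i, cCk k (g i)) -> cCk k (fun x => \sum_(i <- r) g i x).
Proof.
move=> Hg; elim: r => [|i r IH].
  under eq_fun do rewrite big_nil; split; exact: Ck_cst.
by under eq_fun do rewrite big_cons; exact: cCkD.
Qed.

Lemma lipschitz_continuous_at f :
  (forall x, exists K : R, forall y, `|x - y| <= 1 -> `|f x - f y| <= K * `|x - y|) ->
  continuous f.
Proof.
move=> H x; have [K HK] := H x; apply/cvgrPdist_lt => e e0.
have d0 : 0 < Num.min 1 (e / (`|K| + 1)).
  by rewrite lt_min ltr01 divr_gt0 // ltr_wpDl.
near=> y.
have : `|x - y| < Num.min 1 (e / (`|K| + 1)).
  by near: y; apply: (@cvgr_dist_lt _ _ _ (nbhs x) _ id x) => //; exact: cvg_id.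
rewrite lt_min => /andP[/ltW y1 ye]; apply: le_lt_trans (HK y y1) _.
apply: le_lt_trans (_ : (`|K| + 1) * `|x - y| < e).
  by rewrite ler_wpM2r // (le_trans (ler_norm K)) // lerDl.
by rewrite mulrC -ltr_pdivlMr // ltr_wpDl.
Unshelve. all: by end_near.
Qed.

End CkCalculus.

Section BlockExponential.
Context {R : realType} {m : nat}.
Implicit Types X H : 'M[R[i]]_m.

Lemma frobenius_block X1 X2 X3 X4 :
  fro (block_mx X1 X2 X3 X4 : 'M[R[i]]_(m + m)) <= fro X1 + fro X2 + fro X3 + fro X4.
Proof.
apply: le_sqr; first by rewrite !addr_ge0 ?frobenius_ge0.
have -> : fro (block_mx X1 X2 X3 X4 : 'M[R[i]]_(m + m)) ^+ 2 =
    fro X1 ^+ 2 + fro X2 ^+ 2 + fro X3 ^+ 2 + fro X4 ^+ 2.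
  rewrite !sqr_frobenius big_split_ord /= -addrA; congr (_ + _).
    rewrite -big_split; apply: eq_bigr => i _ /=; rewrite big_split_ord /=.
    by congr (_ + _); apply: eq_bigr => j _; rewrite ?block_mxEul ?block_mxEur.
  rewrite -big_split; apply: eq_bigr => i _ /=; rewrite big_split_ord /=.
  by congr (_ + _); apply: eq_bigr => j _; rewrite ?block_mxEdl ?block_mxEdr.
have := frobenius_ge0 X1; have := frobenius_ge0 X2.
have := frobenius_ge0 X3; have := frobenius_ge0 X4.
move: (fro X1) (fro X2) (fro X3) (fro X4) => a b c d *; nra.
Qed.

(** The difference quotient of the exponential is itself a block of an
    exponential, since powers of the block matrix have difference quotients of
    powers in their upper right corner. *)
Lemma expmx_difference_quotient X H (t : R[i]) : t != 0 ->
  ursubmx (expmx (block_mx (X + t *: H) H 0 X)) = t^-1 *: (expmx (X + t *: H) - expmx X).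
Proof.
move=> t0; apply: (scalerI t0); rewrite scalerA divff // scale1r.
apply: (linear_expmxB (f := fun Z => t *: ursubmx Z)) => [a Y Z|k].
  by apply/matrixP => i j; rewrite !mxE mulrDr mulrCA.
have [Q [-> <-]] : exists Q, (block_mx (X + t *: H) H 0 X) ^+ k =
    block_mx ((X + t *: H) ^+ k) Q 0 (X ^+ k) /\ t *: Q = (X + t *: H) ^+ k - X ^+ k.
  elim: k => [|k [Q [E tQ]]].
    exists 0; rewrite !expr0 scaler0 subrr; split=> //.
    by rewrite -[LHS]/(1%:M) scalar_mx_block.
  exists ((X + t *: H) * Q + H * X ^+ k); split.
    rewrite exprS E -mulmxE mulmx_block !exprS -!mulmxE.
    by rewrite !mulmx0 !mul0mx !addr0 !add0r.
  rewrite scalerDr mxscaleAr tQ mxscaleAl mulrBr -exprS [X ^+ k.+1]exprS.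
  by rewrite [(X + _) * X ^+ k]mulrDl opprD addrA subrK.
by rewrite block_mxKur.
Qed.

End BlockExponential.

Section SmoothExponential.
Context {R : realType} {V : normedModType R}.

(** The parameters form a real vector space, so affine is meant over the reals. The
    matrix depends on the parameter in an arbitrary affine way because the derivatives of
    the exponential involve larger block matrices, as in [real_affine_block]. *)
Definition real_affine m (L L' : V -> 'M[R[i]]_m) :=
  (forall (x v : V) (t : R), L (x + t *: v) = L x + t%:C *: L' v) /\
  exists K : R, forall v, fro (L' v) <= K * `|v|.

Lemma real_affine_block m (L L' : V -> 'M[R[i]]_m) v : real_affine L L' ->
  real_affine (fun x => block_mx (L x) (L' v) 0 (L x) : 'M[R[i]]_(m + m))
    (fun u => block_mx (L' u) 0 0 (L' u)).
Proof.
move=> [HL [K HK]]; split=> [x u t|].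
  by rewrite HL scale_block_mx add_block_mx !scaler0 !addr0.
exists (2 * K) => u; apply: le_trans (frobenius_block _ _ _ _) _.
by rewrite !frobenius0 !addr0 -mulrA mulr_natl mulr2n lerD.
Qed.

Lemma real_affine_sub m (L L' : V -> 'M[R[i]]_m) x y : real_affine L L' ->
  L x - L y = L' (x - y).
Proof.
move=> [HL _]; have := HL y (x - y) 1.
by rewrite !scale1r addrC subrK => ->; rewrite addrAC subrr add0r.
Qed.

Lemma expmx_affine_lipschitz m (L L' : V -> 'M[R[i]]_m) x : real_affine L L' ->
  exists K : R, forall y, `|x - y| <= 1 ->
    fro (expmx (L x) - expmx (L y)) <= K * `|x - y|.
Proof.
move=> HL; have [_ [K HK]] := HL.
exists (expR (fro (L x) + `|K|) * `|K|) => y xy1.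
have Lxy : fro (L x - L y) <= `|K| * `|x - y|.
  rewrite (real_affine_sub _ _ HL); apply: le_trans (HK _) _.
  by rewrite ler_wpM2r // ler_norm.
have Ly : fro (L y) <= fro (L x) + `|K|.
  rewrite -[L y](subrK (L x)) addrC; apply: le_trans (frobeniusD _ _) _.
  rewrite lerD2l -frobeniusN opprB; apply: le_trans Lxy _.
  by rewrite ler_piMr.
apply: le_trans (expmx_lipschitz _ Ly) _; first by rewrite lerDl.
by rewrite -mulrA ler_wpM2l ?expR_ge0.
Qed.

Lemma complex_part_le (part : {additive R[i] -> R}) m (X Y : 'M[R[i]]_m) i j :
  (forall z, `|part z| <= normc z) -> `|part (X i j) - part (Y i j)| <= fro (X - Y).
Proof.
move=> Hp; rewrite -raddfB; apply: le_trans (Hp _) _.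
by have := entry_le_frobenius (X - Y) i j; rewrite !mxE.
Qed.

(** By [expmx_difference_quotient], the derivative is again an entry of the exponential of
    a matrix that is affine in [x]: this is what makes the induction of [Ck_expmx_part]
    run. [part] stands for the real or the imaginary part. *)
Lemma is_derive_expmx (part : {additive R[i] -> R}) m (L L' : V -> 'M[R[i]]_m) i j x v :
  (forall z, `|part z| <= normc z) ->
  (forall (t : R) z, part (t%:C * z) = t * part z) ->
  real_affine L L' ->
  is_derive x v (fun x => part (expmx (L x) i j) : R^o)
    (part (expmx (block_mx (L x) (L' v) 0 (L x) : 'M[R[i]]_(m + m))
      (lshift m i) (rshift m j))).
Proof.
move=> Hp HZ HL; have [HLa _] := HL.
set f := (fun x => _); set df := part _.
suff cvg_quotient :
    (fun h : R => h^-1 *: ((f \o shift x) (h *: v) - f x)) @ 0^' --> (df : R^o).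
  apply: DeriveDef; first by apply/cvg_ex; exists df.
  exact: cvg_lim.
pose B (h : R) := block_mx (L x + h%:C *: L' v) (L' v) 0 (L x) : 'M[R[i]]_(m + m).
have B0 : B 0 = block_mx (L x) (L' v) 0 (L x) by rewrite /B scale0r addr0.
pose M := fro (B 0) + fro (L' v).
have BB (h : R) : fro (B 0 - B h) <= `|h| * fro (L' v).
  rewrite B0 /B opp_block_mx add_block_mx opprD addrA !subrr sub0r.
  apply: le_trans (frobenius_block _ _ _ _) _.
  by rewrite !frobenius0 !addr0 frobeniusN frobeniusZ normc_real.
apply/cvgrPdist_lt => e e0.
pose K := expR M * fro (L' v).
have K0 : 0 <= K by rewrite mulr_ge0 ?expR_ge0 ?frobenius_ge0.
have d0 : 0 < Num.min 1 (e / (K + 1)) by rewrite lt_min ltr01 divr_gt0 // ltr_wpDl.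
near=> h.
have h0 : h != 0 by near: h; exact: nbhs_dnbhs_neq.
have : `|h| < Num.min 1 (e / (K + 1)) by near: h; exact: dnbhs0_lt.
rewrite lt_min => /andP[/ltW h1 he].
have quotE : h^-1 *: ((f \o shift x) (h *: v) - f x) =
    part (expmx (B h) (lshift m i) (rshift m j)) :> R.
  rewrite /f /= [h *: v + x]addrC HLa.
  have hC : h%:C != 0 by rewrite fmorph_eq0.
  have -> : expmx (B h) (lshift m i) (rshift m j) = ursubmx (expmx (B h)) i j.
    by rewrite !mxE.
  by rewrite expmx_difference_quotient // mxE -fmorphV HZ !mxE (raddfB part).
rewrite quotE /df -B0.
apply: le_lt_trans (complex_part_le _ _ _ _ Hp) _.
have Mh : fro (B h) <= M.
  rewrite -[B h](subrK (B 0)) addrC; apply: le_trans (frobeniusD _ _) _.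
  rewrite lerD2l -frobeniusN opprB; apply: le_trans (BB h) _.
  by rewrite ler_piMl ?frobenius_ge0.
apply: le_lt_trans (expmx_lipschitz _ Mh) _; first by rewrite lerDl frobenius_ge0.
apply: (@le_lt_trans _ _ (K * `|h|)).
  by rewrite /K -mulrA ler_wpM2l ?expR_ge0 // mulrC; exact: BB.
apply: (@le_lt_trans _ _ ((K + 1) * `|h|)); first by rewrite ler_wpM2r // lerDl.
by rewrite mulrC -ltr_pdivlMr // ltr_wpDl.
Unshelve. all: by end_near.
Qed.

Lemma continuous_expmx_part (part : {additive R[i] -> R}) m (L L' : V -> 'M[R[i]]_m) i j :
  (forall z, `|part z| <= normc z) -> real_affine L L' ->
  continuous (fun x => part (expmx (L x) i j) : R^o).
Proof.
move=> Hp HL; apply: lipschitz_continuous_at => x.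
have [K HK] := expmx_affine_lipschitz x HL; exists K => y xy.
exact: le_trans (complex_part_le _ _ _ _ Hp) (HK y xy).
Qed.

Lemma Ck_expmx_part (part : {additive R[i] -> R}) k :
  (forall z, `|part z| <= normc z) ->
  (forall (t : R) z, part (t%:C * z) = t * part z) ->
  forall m (L L' : V -> 'M[R[i]]_m) i j, real_affine L L' ->
  Ck k (fun x => part (expmx (L x) i j) : R^o).
Proof.
move=> Hp HZ; elim: k => [|k IH] m L L' i j HL.
  by split=> //; exact: continuous_expmx_part HL.
split=> [|v]; first exact: continuous_expmx_part HL.
have D x := is_derive_expmx i j x v Hp HZ HL.
split=> [x|]; first by have [] := D x.
rewrite (_ : 'D_v _ = fun x =>
  part (expmx (block_mx (L x) (L' v) 0 (L x) : 'M[R[i]]_(m + m))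
    (lshift m i) (rshift m j)) : R^o).
  exact: IH (real_affine_block v HL).
by apply/funext => x; have [] := D x.
Qed.

Lemma cCk_expmx k m (L L' : V -> 'M[R[i]]_m) i j : real_affine L L' ->
  cCk k (fun x => expmx (L x) i j).
Proof.
move=> HL; split.
  apply: (@Ck_expmx_part (@complex.Re R) k _ _ _ _ L') => //.
    exact: Re_le_normc.
  by move=> t [a b] /=; rewrite mul0r subr0.
apply: (@Ck_expmx_part (@complex.Im R) k _ _ _ _ L') => //.
  exact: Im_le_normc.
by move=> t [a b] /=; rewrite mul0r addr0.
Qed.

End SmoothExponential.

(** * Regularity in the transform *)

Section Regularity.
Context {R : realType} {n p : nat}.
Implicit Types (A B : tensor R n p) (Phi Psi : 'M[R[i]]_p).

Definition mx_of_pair (X : 'M[R]_p * 'M[R]_p) : 'M[R[i]]_p :=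
  \matrix_(i, j) (X.1 i j +i* X.2 i j).

Lemma slice_linear A (a : R[i]) Phi Psi w :
  slice (Phi + a *: Psi) A w = slice Phi A w + a *: slice Psi A w.
Proof.
rewrite /slice scaler_sumr -big_split; apply: eq_bigr => k _ /=.
by rewrite !mxE scalerDl scalerA.
Qed.

Lemma slice_le A Phi w (d : R) : (forall k, normc (Phi w k) <= d) ->
  fro (slice Phi A w) <= d * \sum_k fro (A k).
Proof.
move=> Hd; apply: le_trans (frobenius_sum _ _ _) _; rewrite mulr_sumr.
by apply: ler_sum => k _; rewrite frobeniusZ ler_wpM2r ?frobenius_ge0.
Qed.

Lemma entry_le_norm (K : numDomainType) (M : 'M[K]_p) i j : `|M i j| <= `|M|.
Proof.
rewrite [leRHS]mx_normE -[leLHS]nngE num_le.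
exact: (le_bigmax _ (fun ij => `|M ij.1 ij.2|%:nng) (i, j)).
Qed.

Lemma slice_affine A w :
  real_affine (fun X => slice (mx_of_pair X) A w) (fun X => slice (mx_of_pair X) A w).
Proof.
split=> [x v t|].
  rewrite -slice_linear; congr (slice _ A w).
  apply/matrixP => i j; rewrite !mxE; apply/eqP.
  by rewrite eq_complex /= !mul0r subr0 addr0 !eqxx.
exists (2 * \sum_k fro (A k)) => v; rewrite mulrAC.
apply: slice_le => k; apply: le_trans (normc_le_ReIm _) _; rewrite !mxE /=.
rewrite mulr_natl mulr2n; apply: lerD; apply: le_trans (entry_le_norm _ _ _) _.
  by rewrite prod_normE le_max lexx.
by rewrite prod_normE le_max lexx orbT.
Qed.

(** A sum over slices does not involve the inverse transform, whose definition by the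
    adjoint is tied to unitary [Phi]. *)
Definition defect_extension A B (Phi : 'M[R[i]]_p) : R[i] :=
  \sum_w GT_gap (slice Phi A w) (slice Phi B w).

Lemma defect_extension_smooth A B : mx_smooth (defect_extension A B).
Proof.
suff H k : cCk k (fun X => defect_extension A B (mx_of_pair X)).
  by split=> k; have [] := H k.
apply: cCk_sum => w; rewrite /GT_gap /mxtrace.
apply: cCkD.
  apply: cCk_sum => i; under eq_fun do rewrite mxE; apply: cCk_sum => j.
  by apply: cCkM; apply: cCk_expmx; exact: slice_affine.
apply: cCkN; apply: cCk_sum => i.
have [HA [KA BA]] := slice_affine A w; have [HB [KB BB]] := slice_affine B w.
apply: (@cCk_expmx _ _ _ _ _
  (fun X => slice (mx_of_pair X) A w + slice (mx_of_pair X) B w)).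
split=> [x v t|]; first by rewrite HA HB scalerDr addrACA.
exists (KA + KB) => v; apply: le_trans (frobeniusD _ _) _.
by rewrite mulrDl lerD.
Qed.

Lemma smooth_defect A B : smooth_on_unitary (fun Phi => defect Phi A B).
Proof.
exists (defect_extension A B); first exact: defect_extension_smooth.
by move=> Phi U; rewrite defectE.
Qed.

Lemma GT_gap_lipschitz (M : R) : exists2 K : R, 0 <= K &
  forall A B A' B' : 'M[R[i]]_n, fro A <= M -> fro B <= M -> fro A' <= M -> fro B' <= M ->
    normc (GT_gap A B - GT_gap A' B') <= K * (fro (A - A') + fro (B - B')).
Proof.
pose E : R := fro (expmx (0 : 'M[R[i]]_n)) + expR `|M| * `|M|.
have E0 : 0 <= E by rewrite addr_ge0 ?frobenius_ge0 // mulr_ge0 ?expR_ge0.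
pose e := expR M; pose e2 := expR (M + M).
have e0 : 0 <= e by rewrite expR_ge0.
have e20 : 0 <= e2 by rewrite expR_ge0.
have expE (X : 'M[R[i]]_n) : fro X <= M -> fro (expmx X) <= E.
  move=> XM; rewrite -[expmx X](subrK (expmx 0)) addrC.
  apply: le_trans (frobeniusD _ _) _; rewrite lerD2l.
  have M0 : 0 <= M := le_trans (frobenius_ge0 _) XM.
  apply: le_trans (expmx_lipschitz XM _) _; first by rewrite frobenius0.
  by rewrite subr0 ger0_norm // ler_wpM2l ?expR_ge0.
exists (E * e + n%:R * e2).
  by rewrite addr_ge0 // mulr_ge0.
move=> A B A' B' AM BM A'M B'M.
have -> : GT_gap A B - GT_gap A' B' =
    (\tr (expmx A *m (expmx B - expmx B')) + \tr ((expmx A - expmx A') *m expmx B'))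
    - \tr (expmx (A + B) - expmx (A' + B')).
  rewrite /GT_gap; move: (expmx A) (expmx A') (expmx B) (expmx B') => a a' b b'.
  move: (expmx (A + B)) (expmx (A' + B')) => c c'.
  by rewrite mulmxBr mulmxBl !(linearB (@mxtrace _ n)) /=; ring.
have sumM (X Y : 'M[R[i]]_n) : fro X <= M -> fro Y <= M -> fro (X + Y) <= M + M.
  by move=> XM YM; apply: le_trans (frobeniusD _ _) _; apply: lerD.
apply: le_trans (normcB _ _) _; rewrite mulrDl; apply: lerD.
  apply: le_trans (normcD _ _) _; rewrite addrC mulrDr; apply: lerD.
    apply: le_trans (normc_trM _ _) _; rewrite mulrC -mulrA.
    by apply: ler_pM; rewrite ?frobenius_ge0 ?expE ?expmx_lipschitz.
  apply: le_trans (normc_trM _ _) _; rewrite -mulrA.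
  by apply: ler_pM; rewrite ?frobenius_ge0 ?expE ?expmx_lipschitz.
apply: le_trans (normc_tr _) _; rewrite -mulrA ler_wpM2l //.
apply: le_trans (expmx_lipschitz (sumM _ _ AM BM) (sumM _ _ A'M B'M)) _.
by rewrite ler_wpM2l // opprD addrACA frobeniusD.
Qed.

(** For unitary [Phi] the slices stay in a ball whose radius depends on [A] and [B] only,
    so one Lipschitz constant serves the whole unitary group. *)
Lemma defect_lipschitz A B : exists2 K : R, 0 <= K & forall Phi Psi : 'M[R[i]]_p,
  Phi \is unitarymx -> Psi \is unitarymx ->
  `|defect Phi A B - defect Psi A B| <= K%:C * `|Phi - Psi|.
Proof.
have [K K0 HK] := GT_gap_lipschitz (tfrobenius A + tfrobenius B).
have a0 : 0 <= tfrobenius A by exact: sqrtr_ge0.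
have b0 : 0 <= tfrobenius B by exact: sqrtr_ge0.
pose S := \sum_k fro (A k) + \sum_k fro (B k).
have S0 : 0 <= S by rewrite addr_ge0 // sumr_ge0 // => k _; exact: frobenius_ge0.
exists (p%:R * K * S); first by rewrite !mulr_ge0.
move=> Phi Psi U V.
have [d dE] : exists d : R, `|Phi - Psi| = d%:C.
  by exists (complex.Re `|Phi - Psi|); rewrite RRe_real // ger0_real.
have entry w k : normc ((Phi - Psi) w k) <= d
  by rewrite -lecR normc_norm -dE entry_le_norm.
rewrite dE !defectE // -sumrB -rmorphM -normc_norm lecR.
apply: le_trans (normc_sum _ _ _) _.
apply: (@le_trans _ _ (\sum_(w < p) K * S * d)); last first.
  by rewrite sumr_const card_ord -[leLHS]mulr_natl !mulrA.
apply: ler_sum => w _.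
have sA Phi' : Phi' \is unitarymx -> fro (slice Phi' A w) <= tfrobenius A + tfrobenius B.
  by move=> U'; apply: le_trans (slice_le_tfrobenius _ _ U') _; rewrite lerDl.
have sB Phi' : Phi' \is unitarymx -> fro (slice Phi' B w) <= tfrobenius A + tfrobenius B.
  by move=> U'; apply: le_trans (slice_le_tfrobenius _ _ U') _; rewrite lerDr.
apply: le_trans (HK _ _ _ _ (sA _ U) (sB _ U) (sA _ V) (sB _ V)) _.
rewrite -mulrA ler_wpM2l // mulrDl.
have diff (T : tensor R n p) : slice Phi T w - slice Psi T w = slice (Phi - Psi) T w.
  by rewrite -(scaleN1r Psi) slice_linear scaleN1r.
by rewrite !diff; apply: lerD; rewrite mulrC; exact: slice_le.
Qed.

Lemma defect_regularity A B :
  let f : mx_space R p -> cplx_space R := fun Phi => defect Phi A B in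
  [/\ {within unitary_group R p, continuous f},
      smooth_on_unitary f
    & forall K : set (mx_space R p), compact K -> K `<=` unitary_group R p ->
        [lipschitz f Phi | Phi in K]].
Proof.
move=> f; have [C C0 HC] := defect_lipschitz A B.
split; last 1 first.
- move=> K _ KU; exists C%:C; split; first by rewrite ger0_real // lecR.
  move=> M CM [x y] [/= Kx Ky].
  apply: le_trans (HC x y (KU _ Kx) (KU _ Ky)) _.
  by rewrite ler_wpM2r // ltW.
- apply/subspace_continuousP => x Ux; apply/cvgrPdist_lt => e e0.
  have C10 : 0 < (C + 1)%:C :> R[i] by rewrite ltcR ltr_wpDl.
  near=> y.
  have Uy : unitary_group R p y by near: y; exact: withinT.
  apply: le_lt_trans (HC x y Ux Uy) _.
  apply: (@le_lt_trans _ _ ((C + 1)%:C * `|x - y|)).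
    by rewrite ler_wpM2r // lecR lerDl.
  rewrite mulrC -ltr_pdivlMr //; near: y; apply: cvg_within.
  apply: (@cvgr_dist_lt _ _ _ (nbhs x) _ id x); first exact: cvg_id.
  exact: divr_gt0 e0 C10.
exact: smooth_defect.
Unshelve. all: by end_near.
Qed.

End Regularity.

Theorem theorem6 (R : realType) :
  (* (i) *)
  (exists C : R -> R -> R,
    (forall a b, 0 < C a b) /\
    forall (n p : nat), (0 < n)%N -> (0 < p)%N ->
    forall (Phi : 'M[R[i]]_p) (A B : tensor R n p),
      Phi \is unitarymx -> thermitian Phi A -> thermitian Phi B ->
      defect Phi A B <=
        (C (tfrobenius A) (tfrobenius B) * noncomm Phi A B)%:C)
  /\
  (* (ii) *)
  (exists c : R, 0 < c /\
    forall (n p : nat), (0 < n)%N -> (0 < p)%N ->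
    forall Phi : 'M[R[i]]_p, Phi \is unitarymx ->
    exists S : set (tensor R n p * tensor R n p),
      positive_measure_class Phi S /\
      forall A B : tensor R n p, S (A, B) ->
        (c * noncomm Phi A B)%:C <= defect Phi A B)
  /\
  (* (iii), sensitivity *)
  (exists C0 : R, 0 < C0 /\
    forall (n p : nat), (1 < n)%N -> (0 < p)%N ->
    exists (A B : tensor R n p) (Phi1 Phi2 : 'M[R[i]]_p),
      [/\ Phi1 \is unitarymx, Phi2 \is unitarymx,
          thermitian Phi2 A /\ thermitian Phi2 B,
          (1 < p)%N -> thermitian Phi1 A /\ thermitian Phi1 B
        & defect Phi1 A B = 0 /\ (C0 * p%:R)%:C <= defect Phi2 A B])
  /\
  (* (iii), regularity in the transform *)
  (forall (n p : nat), (0 < n)%N -> (0 < p)%N ->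
    forall A B : tensor R n p,
      let f : mx_space R p -> cplx_space R := fun Phi => defect Phi A B in
      [/\ {within unitary_group R p, continuous f},
          smooth_on_unitary f
        & forall K : set (mx_space R p), compact K -> K `<=` unitary_group R p ->
            [lipschitz f Phi | Phi in K]])
  /\
  (* (iv) *)
  (forall (n p : nat), (0 < n)%N -> (0 < p)%N ->
    forall (Phi : 'M[R[i]]_p) (A B : tensor R n p),
      Phi \is unitarymx -> thermitian Phi A -> thermitian Phi B ->
      (forall w : 'I_p, commx (slice Phi A w) (slice Phi B w) = 0) ->
      defect Phi A B = 0)
  /\
  (* two-sided equivalence on classes of positive measure *)
  (exists c C : R, [/\ 0 < c, 0 < C &
    forall (n p : nat), (0 < n)%N -> (0 < p)%N ->
    forall Phi : 'M[R[i]]_p, Phi \is unitarymx ->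
    exists S : set (tensor R n p * tensor R n p),
      positive_measure_class Phi S /\
      forall A B : tensor R n p, S (A, B) ->
        (c * noncomm Phi A B)%:C <= defect Phi A B /\
        defect Phi A B <= (C * noncomm Phi A B)%:C])
  /\
  (* nontrivial dependence on the transform *)
  (forall (n p : nat), (1 < n)%N -> (0 < p)%N ->
    exists (A B : tensor R n p) (Phi1 Phi2 : 'M[R[i]]_p),
      [/\ Phi1 \is unitarymx, Phi2 \is unitarymx,
          thermitian Phi2 A /\ thermitian Phi2 B,
          (1 < p)%N -> thermitian Phi1 A /\ thermitian Phi1 B
        & defect Phi1 A B <> defect Phi2 A B]).
Proof.
split.
  exists GT_constant; split=> [a b|n p _ _ Phi A B U hA hB].
    by rewrite mulr_gt0 ?expR_gt0.
  by have /andP[] := defect_bounds U hA hB.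
split.
  exists (1 / 48); split; first by rewrite divr_gt0.
  move=> n p _ _ Phi U; exists (small_pairs Phi (@class_radius R n)); split.
    exact: small_pairs_positive class_radius_gt0 U.
  by move=> A B /(small_pairs_bounds U)/andP[].
split.
  by exists 1; split=> // n p n1 p0; exact: sensitivity.
split; first by move=> n p _ _ A B; exact: defect_regularity.
split; first by move=> n p _ _ Phi A B; exact: defect_commuting.
split.
  exists (1 / 48), (1 / 12); split; rewrite ?divr_gt0 //.
  move=> n p _ _ Phi U; exists (small_pairs Phi (@class_radius R n)); split.
    exact: small_pairs_positive class_radius_gt0 U.
  by move=> A B /(small_pairs_bounds U)/andP[].
move=> n p n1 p0.
have [A [B [Phi1 [Phi2 [U1 U2 h2 h1 [D1 D2]]]]]] := @sensitivity R n n1 p p0.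
exists A, B, Phi1, Phi2; split; [exact: U1 | exact: U2 | exact: h2 | exact: h1 |].
move=> E; have : (1 * p%:R)%:C <= (0 : R[i]) by rewrite -D1 E.
by rewrite lecR mul1r leNgt ltr0n p0.
Qed.
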